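(* Let $X=\ell_p(\mathbb Z)$ with $p\in[1,+\infty)$, or $X=c_0(\mathbb Z)$, and let $B_w$ be an invertible bilateral weighted shift acting on $X$, associated with a sequence $w=(w_n)_{n\in\mathbb Z}$ of positive real numbers. Then $B_w$ is strongly structurally stable if and only if $B_w$ has the shadowing property.
   Context: The spaces $\ell_p(\mathbb Z)$ and $c_0(\mathbb Z)$ are the usual complex Banach spaces of sequences indexed by $\mathbb Z$. For a sequence $w=(w_n)_{n\in\mathbb Z}$ of positive real numbers, the bilateral weighted shift is $B_w\big((x_n)_{n\in\mathbb Z}\big)=(w_{n+1}x_{n+1})_{n\in\mathbb Z}$. It is a bounded invertible operator on $X$ exactly when $0<\inf_n w_n\le\sup_n w_n<+\infty$. For a map $\alpha:X\to X$, $\|\alpha\|_\infty=\sup_{x\in X}\|\alpha(x)\|$ and, if $\alpha$ is Lipschitz, $\mathrm{Lip}(\alpha)$ denotes its (best) Lipschitz constant; $\mathrm{Lip}(X)$ is the set of Lipschitz maps from $X$ to $X$. A bounded operator $T$ on a complex Banach space $X$ is strongly structurally stable if for every $\varepsilon>0$ there exists $\delta>0$ such that, for any $\alpha\in\mathrm{Lip}(X)$ with $\|\alpha\|_\infty\le\delta$ and $\mathrm{Lip}(\alpha)\le\delta$, there is a map $\varphi:X\to X$ with $\|\varphi\|_\infty\le\varepsilon$ such that $I+\varphi$ is a homeomorphism of $X$ onto $X$ and $T\circ(I+\varphi)=(I+\varphi)\circ(T+\alpha)$, where $I$ is the identity map. For $\delta>0$, a sequence $(x_n)_{n\in\mathbb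 Z}$ in $X$ is a $\delta$-pseudotrajectory of a bounded operator $T$ on $X$ if $\|Tx_n-x_{n+1}\|\le\delta$ for all $n\in\mathbb Z$. An invertible operator $T$ has the shadowing property if for every $\varepsilon>0$ there exists $\delta>0$ such that for every $\delta$-pseudotrajectory $(x_n)_{n\in\mathbb Z}$ of $T$ there exists $x\in X$ with $\|T^nx-x_n\|<\varepsilon$ for all $n\in\mathbb Z$. *)

(* Defs.v *)
From HB Require Import structures.
From mathcomp Require Import all_boot all_order all_algebra.
From mathcomp Require Import complex.
From mathcomp Require Import all_classical all_reals all_analysis.
From mathcomp Require Import ring lra.

Set Implicit Arguments.
Unset Strict Implicit.
Unset Printing Implicit Defensive.

Import Order.TTheory GRing.Theory Num.Theory.
Import numFieldNormedType.Exports.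

Local Open Scope classical_set_scope.
Local Open Scope ring_scope.
Local Open Scope complex_scope.

(* Norms over R[i] take values in R[i]; rnorm is the same norm as a real
   number (lemma rnormE). *)
Definition rnorm (R : realType) (V : normedZmodType R[i]) (v : V) : R :=
  complex.Re `|v|.

Section RealNorm.
Context {R : realType}.

Lemma rnormE (V : normedZmodType R[i]) (v : V) : `|v| = (rnorm v)%:C.
Proof.
have := normr_ge0 v; rewrite /rnorm; case: `|v| => a b.
by rewrite lecE /= => /andP[/eqP -> _].
Qed.

Lemma rnorm_ge0 (V : normedZmodType R[i]) (v : V) : 0 <= rnorm v.
Proof. by rewrite -ler0c -rnormE. Qed.

Lemma rnorm0 (V : normedZmodType R[i]) : rnorm (0 : V) = 0.
Proof. by rewrite /rnorm normr0. Qed.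

Lemma rnorm0_eq0 (V : normedZmodType R[i]) (v : V) : rnorm v = 0 -> v = 0.
Proof. by move=> v0; apply/eqP; rewrite -normr_eq0 rnormE v0. Qed.

Lemma ler_rnormD (V : normedZmodType R[i]) (u v : V) :
  rnorm (u + v) <= rnorm u + rnorm v.
Proof. by rewrite -lecR rmorphD /= -!rnormE ler_normD. Qed.

Lemma rnormN (V : normedZmodType R[i]) (v : V) : rnorm (- v) = rnorm v.
Proof. by rewrite /rnorm normrN. Qed.

Lemma rnormM (a b : R[i]) : rnorm (a * b) = rnorm a * rnorm b.
Proof. by apply: complexI; rewrite rmorphM /= -!rnormE normrM. Qed.

End RealNorm.

Section PowerSums.
Context {R : realType}.
Implicit Types (p a b : R) (f g : int -> R) (s : seq int).

Lemma convex_combi_powR p (t x y : R) : 1 <= p -> 0 <= t <= 1 ->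
  0 <= x -> 0 <= y ->
  (t * x + (1 - t) * y) `^ p <= t * x `^ p + (1 - t) * y `^ p.
Proof.
move=> p1 /andP[t0 t1] x0 y0.
have := @convex_powR R p p1 (Itv01 t0 t1) x y.
by rewrite !inE /= !in_itv /= !andbT !convRE /=; exact.
Qed.

Lemma fin_minkowski p a b f g s : 1 <= p -> 0 <= a -> 0 <= b ->
  (forall i, 0 <= f i) -> (forall i, 0 <= g i) ->
  \sum_(i <- s) f i `^ p <= a `^ p -> \sum_(i <- s) g i `^ p <= b `^ p ->
  \sum_(i <- s) (f i + g i) `^ p <= (a + b) `^ p.
Proof.
move=> p1 a0 b0 f0 g0 fa gb.
have pn0 : p != 0 by rewrite gt_eqF// (lt_le_trans ltr01).
have p0 : 0 <= p by rewrite (le_trans ler01).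
have zero h : \sum_(i <- s) h i `^ p <= 0 :> R -> {in s, forall i, h i = 0 :> R}.
  move=> h0 i si; have : \sum_(i <- s) h i `^ p == 0.
    by rewrite eq_le h0 sumr_ge0// => j _; rewrite powR_ge0.
  rewrite psumr_eq0; last by move=> j _; rewrite powR_ge0.
  by move=> /allP /(_ i si) /=; rewrite powR_eq0 => /andP[/eqP].
move: a0; rewrite le_eqVlt => /predU1P[a0|a0].
  rewrite -a0 powR0// in fa; rewrite -a0 add0r.
  by rewrite (eq_big_seq (fun i => g i `^ p))// => i si; rewrite (zero f fa i si) add0r.
move: b0; rewrite le_eqVlt => /predU1P[b0|b0].
  rewrite -b0 powR0// in gb; rewrite -b0 addr0.
  by rewrite (eq_big_seq (fun i => f i `^ p))// => i si; rewrite (zero g gb i si) addr0.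
set t := a / (a + b).
have ab0 : 0 < a + b by rewrite addr_gt0.
have tE : 1 - t = b / (a + b) by rewrite /t; field; rewrite gt_eqF.
have t0 : 0 <= t by rewrite divr_ge0// ltW.
have t1 : 0 <= 1 - t by rewrite tE divr_ge0// ltW.
have key i : (f i + g i) `^ p <=
   (a + b) `^ p * (t * (f i / a) `^ p + (1 - t) * (g i / b) `^ p).
  have -> : f i + g i = (a + b) * (t * (f i / a) + (1 - t) * (g i / b)).
    by rewrite tE /t; field; rewrite !gt_eqF.
  rewrite powRM; [|exact: ltW|]; last first.
    by rewrite addr_ge0// mulr_ge0// divr_ge0// ltW.
  apply: ler_wpM2l; first exact: powR_ge0.
  apply: convex_combi_powR => //.
  - by rewrite t0 -subr_ge0.
  - by rewrite divr_ge0// ltW.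
  - by rewrite divr_ge0// ltW.
have sumdiv h c : 0 < c -> (forall i, 0 <= h i) ->
    \sum_(i <- s) h i `^ p <= c `^ p -> \sum_(i <- s) (h i / c) `^ p <= 1 :> R.
  move=> c0 h0 hc.
  rewrite (eq_bigr (fun i => h i `^ p * (c `^ p)^-1)); last first.
    move=> i _; rewrite powRM ?invr_ge0 ?(ltW c0)//; congr (_ * _).
    have cp0 : c `^ p != 0 by rewrite gt_eqF// powR_gt0.
    apply: (mulIf cp0); rewrite mulVf// -powRM ?invr_ge0 ?(ltW c0)//.
    by rewrite mulVf ?gt_eqF// powR1.
  by rewrite -mulr_suml ler_pdivrMr ?powR_gt0// mul1r.
apply: (@le_trans _ _ (\sum_(i <- s) (a + b) `^ p *
    (t * (f i / a) `^ p + (1 - t) * (g i / b) `^ p))).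
  by apply: ler_sum.
rewrite -mulr_sumr -[leRHS]mulr1 ler_wpM2l ?powR_ge0//.
rewrite big_split /= -!mulr_sumr -[leRHS](subrKC t).
by rewrite lerD// -[leRHS]mulr1 ler_wpM2l// sumdiv.
Qed.

Lemma esum_le_seqP (f : int -> R) (c : R) :
  (\esum_(n in [set: int]) (f n)%:E <= c%:E)%E <->
  (forall s : seq int, uniq s -> \sum_(i <- s) f i <= c).
Proof.
split=> [fc s us|fc].
  rewrite -lee_fin; apply: le_trans fc; apply: esum_ge.
  exists [set` s]; first by split => //; exact: finite_seq.
  by rewrite fsumEFin ?finite_seq//= -fsbig_seq.
rewrite /esum; apply: ge_ereal_sup; move=> _ [A [finA _] <-].
rewrite fsumEFin// lee_fin fsbig_finite//=; apply: fc; exact: finmap.fset_uniq.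
Qed.

End PowerSums.

Section Completeness.
Context {R : realType} (V : normedModType R[i]).
Implicit Types F : set_system V.

Lemma cauchy_rnorm F : ProperFilter F -> cauchy F -> forall e : R, 0 < e ->
  exists2 A, F A & forall x y, A x -> A y -> rnorm (x - y) <= e.
Proof.
move=> FF /cauchyP Fc e e0.
have e20 : 0 < (e / 2)%:C :> R[i] by rewrite ltcR divr_gt0.
have [x Fx] := Fc _ e20; exists (ball x (e / 2)%:C) => // y z.
rewrite -!ball_normE /= !rnormE !ltcR => xy xz.
have -> : y - z = - (x - y) + (x - z) by rewrite opprB addrA subrK.
by rewrite (le_trans (ler_rnormD _ _))// rnormN (splitr e) lerD// ltW.
Qed.

Lemma rnorm_cvg F (l : V) : ProperFilter F ->
  (forall e : R, 0 < e -> exists2 A, F A & forall x, A x -> rnorm (x - l) <= e) ->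
  cvg F.
Proof.
move=> FF Fl; apply/cvg_ex; exists l; apply/fcvg_ballP => -[e i].
rewrite ltcE /= => /andP[/eqP-> e0].
have [A FA Al] := Fl (e / 2) (divr_gt0 e0 (ltr0Sn _ 1)).
apply: filterS FA => x /Al xl.
rewrite -ball_normE /= distrC rnormE ltcR (le_lt_trans xl)//.
by rewrite ltr_pdivrMr// ltr_pMr// ltr1n.
Qed.

Lemma coord_lim (c : int -> V -> R[i]) F :
  (forall n x y, c n (x - y) = c n x - c n y) ->
  (forall n x, rnorm (c n x) <= rnorm x) ->
  ProperFilter F -> cauchy F ->
  exists l : int -> R[i], forall n (e : R), 0 < e ->
    exists2 A, F A & forall x, A x -> rnorm (c n x - l n) <= e.
Proof.
move=> cB cle FF Fc.
have real_lim (h : V -> R) : (forall x y, `|h x - h y| <= rnorm (x - y)) ->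
    exists a : R, forall e : R, 0 < e ->
      exists2 A, F A & forall x, A x -> `|h x - a| <= e.
  move=> hle; have : cvg (h @ F).
    apply: cauchy_cvg; apply/cauchy_exP => e e0.
    have [A FA Ae] := cauchy_rnorm FF Fc (divr_gt0 e0 (ltr0Sn _ 1)).
    have [x Ax] := filter_ex FA; exists (h x).
    suff: F (h @^-1` ball (h x) e) by []; apply: filterS FA => y Ay.
    rewrite -ball_normE /=; apply: le_lt_trans (hle _ _) _; apply: le_lt_trans (Ae _ _ Ax Ay) _.
    by rewrite ltr_pdivrMr// ltr_pMr// ltr1n.
  move=> /cvg_ex[a ha]; exists a => e e0.
  exists [set x | `|h x - a| <= e] => //.
  by move/cvgrPdist_le: ha => /(_ e e0); apply: filterS => x /=; rewrite distrC.
have Rele (z : R[i]) : `|complex.Re z| <= rnorm z.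
  by rewrite -lecR -rnormE normc_ge_Re.
have Imle (z : R[i]) : `|complex.Im z| <= rnorm z.
  rewrite /rnorm normc_def /= -sqrtr_sqr ler_wsqrtr//.
  by rewrite lerDr sqr_ge0.
have ReB n x y : complex.Re (c n x) - complex.Re (c n y) = complex.Re (c n (x - y)).
  by rewrite cB; case: (c n x) (c n y) => [? ?] [].
have ImB n x y : complex.Im (c n x) - complex.Im (c n y) = complex.Im (c n (x - y)).
  by rewrite cB; case: (c n x) (c n y) => [? ?] [].
have /choice[a aP] : forall n, exists r : R, forall e : R, 0 < e ->
    exists2 A, F A & forall x, A x -> `|complex.Re (c n x) - r| <= e.
  by move=> n; apply: real_lim => x y; rewrite ReB (le_trans (Rele _)).
have /choice[b bP] : forall n, exists r : R, forall e : R, 0 < e ->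
    exists2 A, F A & forall x, A x -> `|complex.Im (c n x) - r| <= e.
  by move=> n; apply: real_lim => x y; rewrite ImB (le_trans (Imle _)).
exists (fun n => (a n +i* b n)) => n e e0.
have e20 : 0 < e / 2 by rewrite divr_gt0.
have [A FA Aa] := aP n _ e20; have [B FB Bb] := bP n _ e20.
exists (A `&` B); first exact: filterI.
move=> x [/Aa xa /Bb xb].
have normle (u v : R) : rnorm (u +i* v) <= `|u| + `|v|.
  rewrite /rnorm normc_def /= -[leRHS]ger0_norm ?addr_ge0// -sqrtr_sqr ler_wsqrtr//.
  rewrite sqrrD !real_normK ?num_real//; set m := `|u| * `|v|.
  have : 0 <= m by rewrite mulr_ge0.
  by rewrite mulr2n; lra.
move: xa xb; case: (c n x) => u v /= xa xb.
apply: (le_trans (normle _ _)).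
by rewrite (splitr e) lerD.
Qed.

Lemma coord_lim_seq (c : int -> V -> R[i]) F (l : int -> R[i]) :
  ProperFilter F ->
  (forall n (e : R), 0 < e ->
    exists2 A, F A & forall x, A x -> rnorm (c n x - l n) <= e) ->
  forall (s : seq int) (e : R), 0 < e -> exists2 A, F A &
    forall x, A x -> {in s, forall n, rnorm (c n x - l n) <= e}.
Proof.
move=> FF lP s e e0; elim: s => [|n s [A FA Ae]].
  by exists setT => //; exact: filterT.
have [B FB Be] := lP n e e0; exists (A `&` B); first exact: filterI.
move=> x [Ax Bx] m; rewrite inE => /predU1P[->|]; first exact: Be.
exact: Ae.
Qed.

End Completeness.

Section LpPred.
Context {R : realType} (p : R) (p1 : 1 <= p).
Implicit Types x y : int -> R[i].

(* The proof of 1 <= p is unused, but it is what makes the instance of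
   submodClosed below inferable from the predicate. *)
Definition ellp_pred (_ : 1 <= p) : {pred int -> R[i]} :=
  fun x => `[< (\esum_(n in [set: int]) (rnorm (x n) `^ p)%:E < +oo)%E >].

Definition ellp_norm x : R :=
  fine (\esum_(n in [set: int]) (rnorm (x n) `^ p)%:E) `^ p^-1.

Let p_gt0 : 0 < p. Proof. exact: lt_le_trans p1. Qed.

Let K (b : R) : 0 <= b -> (b `^ p) `^ p^-1 = b.
Proof. by move=> b0; rewrite -powRrM mulfV ?gt_eqF// powRr1. Qed.

Let K' (b : R) : 0 <= b -> (b `^ p^-1) `^ p = b.
Proof. by move=> b0; rewrite -powRrM mulVf ?gt_eqF// powRr1. Qed.

Lemma ellp_norm_ge0 x : 0 <= ellp_norm x.
Proof. exact: powR_ge0. Qed.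

Lemma ellp_normP x (a : R) : 0 <= a ->
  (x \in ellp_pred p1 /\ ellp_norm x <= a) <->
  (forall s, uniq s -> \sum_(i <- s) rnorm (x i) `^ p <= a `^ p).
Proof.
move=> a0; rewrite -esum_le_seqP.
have esum0 : (0 <= \esum_(n in [set: int]) (rnorm (x n) `^ p)%:E)%E.
  by apply: esum_ge0 => n _; rewrite lee_fin powR_ge0.
rewrite unfold_in /= /ellp_norm.
move: esum0; case: esum => [S| |] //=; last first.
  by move=> _; split=> [[/asboolP]|].
rewrite lee_fin => S0; split.
  move=> [_ Sa]; rewrite lee_fin -[leLHS]K'// ge0_ler_powR ?nnegrE ?powR_ge0//.
  exact: ltW.
rewrite lee_fin => Sa; split; first by apply/asboolP; rewrite ltry.
rewrite -[leRHS]K// ge0_ler_powR ?nnegrE ?powR_ge0// invr_ge0.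
exact: ltW.
Qed.

Lemma ellp_sum_le x s : x \in ellp_pred p1 -> uniq s ->
  \sum_(i <- s) rnorm (x i) `^ p <= ellp_norm x `^ p.
Proof.
move=> xp; have [+ _] := ellp_normP x (ellp_norm_ge0 x).
by move=> /(_ (conj xp (lexx _))); exact.
Qed.

Lemma powR_le_eps (S e : R) : 0 <= S -> 0 <= e ->
  (forall d, 0 < d -> S <= (e + d) `^ p) -> S <= e `^ p.
Proof.
move=> S0 e0 Se; rewrite -(K' S0); apply: ge0_ler_powR.
- exact: ltW.
- by rewrite nnegrE powR_ge0.
- by rewrite nnegrE.
apply/ler_addgt0Pr => d d0; rewrite -(K (addr_ge0 e0 (ltW d0))).
apply: ge0_ler_powR; rewrite ?nnegrE ?powR_ge0//; last exact: Se.
by rewrite invr_ge0 ltW.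
Qed.

Lemma powR_divK (d m : R) : 0 <= d -> 0 < m ->
  (d / m `^ p^-1) `^ p = d `^ p / m.
Proof.
move=> d0 m0; have q0 := powR_gt0 p^-1 m0.
rewrite powRM ?invr_ge0 ?(ltW q0)//; congr (_ * _).
apply: (mulIf (lt0r_neq0 m0)).
rewrite mulVf ?gt_eqF// -{2}(K' (ltW m0)) -powRM ?invr_ge0 ?(ltW q0)//.
by rewrite mulVf ?gt_eqF// powR1.
Qed.

Lemma ellp_coord x n : x \in ellp_pred p1 -> rnorm (x n) <= ellp_norm x.
Proof.
move=> xp; have := ellp_sum_le xp (isT : uniq [:: n]).
rewrite big_seq1 => h.
rewrite -[leLHS](K (rnorm_ge0 (x n))) -[leRHS](K (ellp_norm_ge0 x)).
rewrite ge0_ler_powR ?nnegrE ?powR_ge0// invr_ge0.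
exact: ltW.
Qed.

Lemma ellpD x y : x \in ellp_pred p1 -> y \in ellp_pred p1 ->
  x + y \in ellp_pred p1 /\ ellp_norm (x + y) <= ellp_norm x + ellp_norm y.
Proof.
move=> xp yp; apply/ellp_normP; first by rewrite addr_ge0// ellp_norm_ge0.
move=> s us; have xs := ellp_sum_le xp us; have ys := ellp_sum_le yp us.
apply: le_trans (fin_minkowski p1 (ellp_norm_ge0 x) (ellp_norm_ge0 y) _ _ xs ys).
- apply: ler_sum => i _; apply: ge0_ler_powR.
  + exact: ltW.
  + by rewrite nnegrE rnorm_ge0.
  + by rewrite nnegrE addr_ge0// rnorm_ge0.
  + exact: ler_rnormD.
- by move=> i; exact: rnorm_ge0.
- by move=> i; exact: rnorm_ge0.
Qed.

Lemma ellpZ_le (k : R[i]) x : x \in ellp_pred p1 ->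
  k *: x \in ellp_pred p1 /\ ellp_norm (k *: x) <= rnorm k * ellp_norm x.
Proof.
move=> xp; apply/ellp_normP; first by apply: mulr_ge0; [exact: rnorm_ge0|exact: ellp_norm_ge0].
move=> s us; rewrite (powRM _ (rnorm_ge0 k) (ellp_norm_ge0 x)).
rewrite (eq_bigr (fun i => rnorm k `^ p * rnorm (x i) `^ p)); last first.
  by move=> i _; rewrite -(powRM _ (rnorm_ge0 k) (rnorm_ge0 (x i))) -rnormM.
by rewrite -mulr_sumr ler_wpM2l ?powR_ge0// ellp_sum_le.
Qed.

Lemma ellp0 : (0 : int -> R[i]) \in ellp_pred p1.
Proof.
suff [] : (0 : int -> R[i]) \in ellp_pred p1 /\ ellp_norm 0 <= 0 by [].
apply/ellp_normP => // s us.
by rewrite big1 ?powR_ge0// => i _; rewrite [X in rnorm X](_ : _ = 0)// rnorm0 powR0// gt_eqF.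
Qed.

Lemma ellp_normZ (k : R[i]) x : x \in ellp_pred p1 ->
  ellp_norm (k *: x) = rnorm k * ellp_norm x.
Proof.
move=> xp; apply/eqP; rewrite eq_le; have [kxp ->] /= := ellpZ_le k xp.
have [->|k0] := eqVneq k 0; first by rewrite rnorm0 mul0r ellp_norm_ge0.
have [_] := ellpZ_le k^-1 kxp; rewrite scalerA mulVf// scale1r.
move=> h; have rk0 : 0 <= rnorm k := rnorm_ge0 k.
apply: le_trans (ler_wpM2l rk0 h) _.
by rewrite mulrA -rnormM divff// [rnorm 1]/rnorm normr1 mul1r.
Qed.

End LpPred.

Record ellp (R : realType) (p : R) (p1 : 1 <= p) : Type :=
  Ellp { ellp_seq :> int -> R[i]; _ : ellp_seq \in ellp_pred p1 }.

Section LpSpace.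
Context {R : realType} (p : R) (p1 : 1 <= p).

HB.instance Definition _ := [isSub for @ellp_seq R p p1].
HB.instance Definition _ := [Choice of ellp p1 by <:].

Lemma ellp_submod_closed : submod_closed (ellp_pred p1).
Proof.
split; first exact: ellp0.
move=> k x y xp yp; have [kxp _] := ellpZ_le k xp.
by have [] := ellpD kxp yp.
Qed.

HB.instance Definition _ :=
  GRing.isSubmodClosed.Build _ _ (ellp_pred p1) ellp_submod_closed.
HB.instance Definition _ := [SubChoice_isSubLmodule of ellp p1 by <:].

Let N (x : ellp p1) : R[i] := (ellp_norm p x)%:C.

Let N_triangle x y : N (x + y) <= N x + N y.
Proof. by rewrite -rmorphD /= lecR; have [] := ellpD (valP x) (valP y). Qed.

Let N_homo (k : R[i]) x : N (k *: x) = `|k| * N x.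
Proof. by rewrite /N (ellp_normZ k (valP x)) rnormE -rmorphM. Qed.

Let N_eq0 x : N x = 0 -> x = 0.
Proof.
move=> /complexI x0; apply/val_inj/funext => n; apply: rnorm0_eq0.
by apply/eqP; rewrite eq_le rnorm_ge0 andbT -x0 ellp_coord// (valP x).
Qed.

HB.instance Definition _ :=
  Lmodule_isNormed.Build R[i] (ellp p1) N_triangle N_homo N_eq0.

Lemma rnorm_ellpE (x : ellp p1) : rnorm x = ellp_norm p x.
Proof. by []. Qed.

Let ellp_complete (F : set_system (ellp p1)) :
  ProperFilter F -> cauchy F -> cvg F.
Proof.
move=> FF Fc; pose c n (x : ellp p1) := ellp_seq x n.
have cle n (x : ellp p1) : rnorm (c n x) <= rnorm x.
  exact: ellp_coord n (valP x).
have [l lP] := coord_lim (fun n x y => erefl : c n (x - y) = c n x - c n y)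
  cle FF Fc.
have key (e : R) : 0 < e -> exists2 A, F A & forall x : ellp p1, A x ->
    (val x - l) \in ellp_pred p1 /\ ellp_norm p (val x - l) <= e.
  move=> e0; have [A FA Ae] := cauchy_rnorm FF Fc e0.
  exists A => // x Ax; apply/ellp_normP; first exact: ltW.
  move=> s us; apply: (powR_le_eps p1); [|exact: ltW|].
    by apply: sumr_ge0 => i _; exact: powR_ge0.
  move=> d d0; set m : R := (size s).+1%:R.
  have m0 : 0 < m by rewrite ltr0n.
  have d'0 : 0 < d / m `^ p^-1 by rewrite divr_gt0// powR_gt0.
  have [B FB Bl] := coord_lim_seq FF lP s d'0.
  have [y [Ay By]] := filter_ex (filterI FA FB).
  have xy : \sum_(i <- s) rnorm ((x - y : ellp p1) i) `^ p <= e `^ p.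
    have [+ _] := ellp_normP p1 (val (x - y)) (ltW e0).
    by apply => //; split; [exact: valP|exact: Ae].
  have yl : \sum_(i <- s) rnorm (y i - l i) `^ p <= d `^ p.
    apply: (@le_trans _ _ (\sum_(i <- s) d `^ p / m)).
      rewrite big_seq [leRHS]big_seq; apply: ler_sum => i si.
      rewrite -(powR_divK p1 (ltW d0) m0).
      apply: ge0_ler_powR; rewrite ?nnegrE ?(ltW d'0)//.
      + exact: le_trans p1.
      + exact: rnorm_ge0.
      + exact: Bl.
    rewrite big_const_seq count_predT iter_addr_0 -mulr_natr -mulrA.
    by rewrite ler_piMr ?powR_ge0// ler_pdivrMl// mulr1 ler_nat.
  apply: le_trans (fin_minkowski p1 (ltW e0) (ltW d0) _ _ xy yl).
  - apply: ler_sum => i _; apply: ge0_ler_powR.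
    + exact: le_trans p1.
    + by rewrite nnegrE rnorm_ge0.
    + by rewrite nnegrE addr_ge0// rnorm_ge0.
    + rewrite (_ : (val x - l) i = (x - y : ellp p1) i + (y i - l i)).
        exact: ler_rnormD.
      by change (x i - l i = x i - y i + (y i - l i)); rewrite addrA subrK.
  - by move=> i; exact: rnorm_ge0.
  - by move=> i; exact: rnorm_ge0.
have [A FA A1] := key 1 ltr01; have [x Ax] := filter_ex FA.
have lp : l \in ellp_pred p1.
  rewrite (_ : l = val x - (val x - l)); last by rewrite opprB addrCA subrr addr0.
  by apply: rpredB; [exact: valP|have [] := A1 x Ax].
apply: (rnorm_cvg (l := Ellp lp)) => e e0.
by have [B FB Be] := key e e0; exists B => // y /Be[].
Qed.

HB.instance Definition _ := Uniform_isComplete.Build (ellp p1) ellp_complete.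

End LpSpace.

Section C0Pred.
Context {R : realType}.
Implicit Types x y : int -> R[i].

Definition c0_pred : {pred int -> R[i]} := fun x =>
  `[< forall e : R, 0 < e ->
      exists N : nat, forall n : int, (N <= `|n|)%N -> rnorm (x n) < e >].

Definition c0_norm x : R := sup (range (fun n : int => rnorm (x n))).

Lemma c0_bounded x : x \in c0_pred -> has_sup (range (fun n => rnorm (x n))).
Proof.
move=> /asboolP /(_ 1 ltr01)[N xN]; split; first by exists (rnorm (x 0)), 0.
exists (1 + \sum_(i < N) (rnorm (x i%:Z) + rnorm (x (- i%:Z)))) => _ [n _ <-].
have sum0 (P : pred 'I_N) :
    0 <= \sum_(i < N | P i) (rnorm (x i%:Z) + rnorm (x (- i%:Z))).
  by apply: sumr_ge0 => i _; apply: addr_ge0; exact: rnorm_ge0.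
have [nN|Nn] := ltnP `|n|%N N; last first.
  by rewrite (le_trans (ltW (xN _ Nn)))// lerDl sum0.
rewrite (bigD1 (Ordinal nN)) //= addrCA; set r := (X in _ <= _ + X).
have r0 : 0 <= r by apply: addr_ge0; [exact: ler01|exact: sum0].
have : rnorm (x n) <= rnorm (x `|n|%N) + rnorm (x (- `|n|%N%:Z)).
  case: (intP n) => [|m|m].
  - by rewrite lerDl; exact: rnorm_ge0.
  - by rewrite lerDl; exact: rnorm_ge0.
  - by rewrite abszN lerDr; exact: rnorm_ge0.
by move=> /le_trans; apply; rewrite lerDl.
Qed.

Lemma c0_normP x (a : R) : x \in c0_pred ->
  c0_norm x <= a <-> (forall n, rnorm (x n) <= a).
Proof.
move=> /c0_bounded xs; split=> [xa n|xa].
  by apply: le_trans xa; apply: (sup_upper_bound xs); exists n.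
by apply: ge_sup; [case: xs|move=> _ [n _ <-]].
Qed.

Lemma c0_coord x n : x \in c0_pred -> rnorm (x n) <= c0_norm x.
Proof. by move=> /(c0_normP (c0_norm x)) [+ _]; exact. Qed.

Lemma c0_submod_closed : submod_closed c0_pred.
Proof.
split.
  apply/asboolP => e e0; exists 0%N => n _.
  by rewrite [X in rnorm X](_ : _ = 0)// rnorm0.
move=> k x y /asboolP x0 /asboolP y0; apply/asboolP => e e0.
have k1 : 0 < rnorm k + 1 by rewrite ltr_wpDl// rnorm_ge0.
have [N xN] := x0 _ (divr_gt0 (divr_gt0 e0 (ltr0Sn _ 1)) k1).
have [M yM] := y0 _ (divr_gt0 e0 (ltr0Sn _ 1)).
exists (maxn N M) => n; rewrite geq_max => /andP[/xN xn /yM yn].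
rewrite [X in rnorm X](_ : _ = k * x n + y n)//.
apply: le_lt_trans (ler_rnormD _ _) _; rewrite rnormM (splitr e).
apply: ler_ltD => //; rewrite ltr_pdivlMr// mulrC in xn.
apply: le_trans (ltW xn); apply: ler_wpM2r; first exact: rnorm_ge0.
by rewrite lerDl.
Qed.

Lemma c0Z_le (k : R[i]) x : x \in c0_pred ->
  k *: x \in c0_pred /\ c0_norm (k *: x) <= rnorm k * c0_norm x.
Proof.
move=> x0; have kx0 : k *: x \in c0_pred.
  have [z0 /(_ k x 0 x0)] := c0_submod_closed.
  by rewrite addr0; apply.
split => //; have [_] := c0_normP (rnorm k * c0_norm x) kx0; apply => n.
rewrite [X in rnorm X](_ : _ = k * x n)// rnormM.
by apply: ler_wpM2l; [exact: rnorm_ge0|exact: c0_coord].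
Qed.

Lemma c0_norm_ge0 x : x \in c0_pred -> 0 <= c0_norm x.
Proof. by move=> x0; apply: le_trans (c0_coord 0 x0); exact: rnorm_ge0. Qed.

Lemma c0_normZ (k : R[i]) x : x \in c0_pred ->
  c0_norm (k *: x) = rnorm k * c0_norm x.
Proof.
move=> xp; apply/eqP; rewrite eq_le; have [kxp ->] /= := c0Z_le k xp.
have [k0|k0] := eqVneq k 0.
  by rewrite {1}k0 rnorm0 mul0r; exact: c0_norm_ge0.
have [_] := c0Z_le k^-1 kxp; rewrite scalerA mulVf// scale1r.
move=> h; have rk0 : 0 <= rnorm k := rnorm_ge0 k.
apply: le_trans (ler_wpM2l rk0 h) _.
by rewrite mulrA -rnormM divff// [rnorm 1]/rnorm normr1 mul1r.
Qed.

End C0Pred.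

Record c0 (R : realType) : Type :=
  C0 { c0_seq :> int -> R[i]; _ : c0_seq \in c0_pred }.

Section C0Space.
Context {R : realType}.

HB.instance Definition _ := [isSub for @c0_seq R].
HB.instance Definition _ := [Choice of c0 R by <:].
HB.instance Definition _ :=
  GRing.isSubmodClosed.Build _ _ (@c0_pred R) c0_submod_closed.
HB.instance Definition _ := [SubChoice_isSubLmodule of c0 R by <:].

Let N (x : c0 R) : R[i] := (c0_norm x)%:C.

Let N_triangle x y : N (x + y) <= N x + N y.
Proof.
rewrite -rmorphD /= lecR; apply/c0_normP; first exact: (valP (x + y)).
move=> n; apply: le_trans (ler_rnormD (x n) (y n)) _.
by apply: lerD; apply: c0_coord; exact: valP.
Qed.

Let N_homo (k : R[i]) x : N (k *: x) = `|k| * N x.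
Proof. by rewrite /N (c0_normZ k (valP x)) rnormE -rmorphM. Qed.

Let N_eq0 x : N x = 0 -> x = 0.
Proof.
move=> /complexI x0; apply/val_inj/funext => n; apply: rnorm0_eq0.
by apply/eqP; rewrite eq_le rnorm_ge0 andbT -x0 c0_coord// (valP x).
Qed.

HB.instance Definition _ :=
  Lmodule_isNormed.Build R[i] (c0 R) N_triangle N_homo N_eq0.

Lemma rnorm_c0E (x : c0 R) : rnorm x = c0_norm x.
Proof. by []. Qed.

Let c0_complete (F : set_system (c0 R)) :
  ProperFilter F -> cauchy F -> cvg F.
Proof.
move=> FF Fc; pose c n (x : c0 R) := c0_seq x n.
have cle n (x : c0 R) : rnorm (c n x) <= rnorm x.
  exact: c0_coord n (valP x).
have [l lP] := coord_lim (fun n x y => erefl : c n (x - y) = c n x - c n y)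
  cle FF Fc.
have key (e : R) : 0 < e -> exists2 A, F A & forall x : c0 R, A x ->
    forall n, rnorm (x n - l n) <= e.
  move=> e0; have [A FA Ae] := cauchy_rnorm FF Fc e0.
  exists A => // x Ax n; apply/ler_addgt0Pr => d d0.
  have [B FB Bl] := lP n d d0.
  have [y [Ay By]] := filter_ex (filterI FA FB).
  rewrite -(subrK (y n) (x n)) -addrA.
  apply: le_trans (ler_rnormD _ _) _; apply: lerD; last exact: Bl.
  exact: le_trans (cle n (x - y)) (Ae x y Ax Ay).
have lc0 : l \in c0_pred.
  apply/asboolP => e e0; have e20 : 0 < e / 2 by rewrite divr_gt0.
  have [A FA Ae] := key _ e20; have [x Ax] := filter_ex FA.
  have /asboolP /(_ _ e20) [M xM] := valP x.
  exists M => n /xM xn; rewrite -(subrK (x n) (l n)).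
  apply: le_lt_trans (ler_rnormD _ _) _; rewrite (splitr e).
  by apply: ler_ltD => //; rewrite -rnormN opprB; exact: Ae.
apply: (rnorm_cvg (l := C0 lc0)) => e e0.
have [B FB Be] := key e e0; exists B => // y By.
by apply/c0_normP; [exact: (valP (y - C0 lc0 : c0 R))|exact: Be].
Qed.

HB.instance Definition _ := Uniform_isComplete.Build (c0 R) c0_complete.

End C0Space.

Section Operators.
Context {R : realType}.

Record bounded_operator (X : normedModType R[i]) : Type := {
  op :> {linear X -> X};
  op_continuous : continuous op
}.

Record invertible_operator (X : normedModType R[i]) : Type := {
  iop :> bounded_operator X;
  iop_inv : bounded_operator X;
  iopK : cancel iop iop_inv;
  iop_invK : cancel iop_inv iop
}.

(* T^n for n in Z; Negz m stands for - m.+1. *)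
Definition op_iter (X : normedModType R[i]) (T : invertible_operator X)
    (n : int) (x : X) : X :=
  match n with
  | Posz m => iter m T x
  | Negz m => iter m.+1 (iop_inv T) x
  end.

Definition weighted_shift (w : int -> R) (x : int -> R[i]) : int -> R[i] :=
  fun n => (w (n + 1))%:C * x (n + 1).

Definition is_lipschitz (X : normedModType R[i]) (f : X -> X) : Prop :=
  exists k : R, k%:C.-lipschitz f.

Definition lipschitz_constant (X : normedModType R[i]) (f : X -> X) : \bar R :=
  ereal_inf [set k%:E | k in [set k : R | 0 <= k /\ k%:C.-lipschitz f]].

Definition sup_norm (X : normedModType R[i]) (f : X -> X) : \bar R :=
  ereal_sup (range (fun x => (rnorm (f x))%:E)).

Definition homeomorphism (X Y : topologicalType) (f : X -> Y) : Prop :=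
  continuous f /\
  exists g : Y -> X, [/\ continuous g, cancel f g & cancel g f].

Definition strongly_structurally_stable (X : completeNormedModType R[i])
    (T : bounded_operator X) : Prop :=
  forall e : R, 0 < e -> exists2 d : R, 0 < d &
    forall a : X -> X, is_lipschitz a ->
      (sup_norm a <= d%:E)%E -> (lipschitz_constant a <= d%:E)%E ->
      exists phi : X -> X,
        [/\ (sup_norm phi <= e%:E)%E,
            homeomorphism (fun x => x + phi x) &
            T \o (fun x => x + phi x) =
            (fun x => x + phi x) \o (fun x => T x + a x)].

Definition pseudotrajectory (X : normedModType R[i])
    (T : bounded_operator X) (d : R) (x : int -> X) : Prop :=
  forall n : int, rnorm (T (x n) - x (n + 1)) <= d.

Definition shadowing_property (X : completeNormedModType R[i])
    (T : invertible_operator X) : Prop :=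
  forall e : R, 0 < e -> exists2 d : R, 0 < d &
    forall x : int -> X, pseudotrajectory T d x ->
      exists y : X, forall n : int, rnorm (op_iter T n y - x n) < e.

End Operators.

(* Main.v *)
Require Import Defs.
From mathcomp Require Import all_boot all_order all_algebra.
From mathcomp Require Import complex.
From mathcomp Require Import all_classical all_reals all_analysis.
From mathcomp Require Import ring lra zify.

Set Implicit Arguments.
Unset Strict Implicit.
Unset Printing Implicit Defensive.

Import Order.TTheory GRing.Theory Num.Theory.
Import numFieldNormedType.Exports.

Local Open Scope ring_scope.

(** Both properties are equivalent to a dichotomy of the weights, and each
    implication through it is short.  The dichotomy asks for a set D of positions
    such that the products of consecutive weights met by an entry moving down
    from a position outside D decay geometrically, while the products collected
    on the way down to a position of D grow geometrically.

    From the dichotomy to the two properties.  The dichotomy supplies a linear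
    map P (the coordinate projection off a set D of positions) such that the
    forward iterates T^n P and the backward iterates T^-n (I - P) decay
    geometrically.  For a bounded sequence z indexed by the integers the series
      G z = sum_(n >= 0) (T^n P z_(-n-1) - T^-(n+1) (I - P) z_n)
    then converges, |G z| <= B sup |z_k|, and G (shift z) = T (G z) + z_0
    ([green_le], [green_shift]).  So y_n = G (z_(n+k))_k solves
    y_(n+1) = T y_n + z_n, and subtracting it from a pseudotrajectory with
    errors z leaves a true orbit ([splitting_shadowing]).  For structural
    stability under a perturbation S = T + a, put
      phi x = - G (a (S^k x))_k      and
      psi x = G (a ((I + psi) (T^k x)))_k,
    the second being a fixed point equation for a contraction.  The shift
    identity makes I + phi and I + psi semiconjugate S and T in opposite
    directions.  No uniqueness of semiconjugacies close to the identity is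
    available, since T may have nonzero bounded orbits; but both maps are given
    by the same G, which is why I + phi and I + psi turn out to be inverse to
    each other ([stable_of_splitting]).

    From the two properties to the dichotomy.  On a diagonal the equation
    y_(n+1) = T y_n + z_n is the scalar recursion a_(i+1) = w_(j-i) a_i + 1
    when the forcing is constant.  Shadowing bounds its solutions at once.
    Structural stability does so on finite segments: a large orbit segment of
    T + a consists of points far apart, so a Lipschitz bump function a can
    prescribe the forcing along it, and y_n = phi x_n is the bounded solution
    ([stable_bounded_forcing]).  A solution of the recursion bounded by K is at
    least 1 from the step after it is nonnegative, and from there on the products
    of weights contract at the rate K / (K + 1); as long as it is negative they
    expand.  The set of positions where it is negative depends on the segment;
    an ultrafilter limit over longer and longer segments gives one set D
    ([wprod_dichotomy]).

    The two families of sequence spaces enter only through the properties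
    collected in [sequence_space]. *)

(** * Geometric convergence and uniform limits for real-valued norms *)

Section Limits.
Context {R : realType}.

Lemma le0_geometric (x b r : R) : 0 <= r < 1 ->
  (forall n, x <= b * r ^+ n) -> x <= 0.
Proof.
move=> /andP[r0 r1] xb.
have rn : ((fun n => b * r ^+ n) @ \oo --> b * 0)%classic.
  by apply: cvgMr; apply: cvg_expr; rewrite ger0_norm.
have xc : ((fun=> x) @ \oo --> x)%classic by exact: cvg_cst.
by rewrite -(mulr0 b); apply: (ler_cvg_to xc rn); exact: nearW.
Qed.

Lemma geometric_lt (b r e : R) : 0 <= r < 1 -> 0 < e ->
  exists n, b * r ^+ n < e.
Proof.
move=> r01 e0; apply: contrapT => /forallNP bn.
suff : e <= 0 by rewrite leNgt e0.
by apply: (le0_geometric (b := b) r01) => n; rewrite leNgt; apply/negP.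
Qed.

Lemma posC_real (e : R[i]) : 0 < e -> exists2 d : R, 0 < d & e = d%:C%C.
Proof.
by case: e => a b; rewrite ltcE /= => /andP[/eqP-> a0]; exists a.
Qed.

Section Normed.
Context {X : normedModType R[i]}.
Implicit Types (x y l : X) (u : nat -> X).

Lemma rnormB x y : rnorm (x - y) = rnorm (y - x).
Proof. by rewrite -rnormN opprB. Qed.

Lemma ler_rnormB x y : rnorm (x - y) <= rnorm x + rnorm y.
Proof. by rewrite -(rnormN y) ler_rnormD. Qed.

Lemma ler_rnorm_sum (I : Type) (s : seq I) (F : I -> X) :
  rnorm (\sum_(i <- s) F i) <= \sum_(i <- s) rnorm (F i).
Proof.
elim: s => [|i s IH]; first by rewrite !big_nil rnorm0.
by rewrite !big_cons (le_trans (ler_rnormD _ _))// lerD2l.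
Qed.

Lemma nbhs_rnormP x (A : set X) : nbhs x A <->
  exists2 e : R, 0 < e & forall y, rnorm (x - y) < e -> A y.
Proof.
split=> [/nbhs_ballP[e /= /posC_real[d d0 ->] dA]|[e e0 eA]].
  exists d => // y xy; apply: dA.
  by rewrite -ball_normE /= rnormE ltcR.
apply/nbhs_ballP; exists e%:C%C; first by rewrite /= ltcR.
by move=> y; rewrite -ball_normE /= rnormE ltcR; exact: eA.
Qed.

Lemma rnorm_geometric_eq0 x (b r : R) : 0 <= r < 1 ->
  (forall n, rnorm x <= b * r ^+ n) -> x = 0.
Proof.
move=> r01 xb; apply: rnorm0_eq0; apply/eqP.
by rewrite eq_le rnorm_ge0 andbT (le0_geometric r01 xb).
Qed.

End Normed.

(** The increments are bounded by (1 - r) b r^n rather than by b r^n, so that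
    the sums telescope and the tail after n is exactly b r^n. *)
Lemma geometric_limit (X : completeNormedModType R[i]) (u : nat -> X)
    (b r : R) : 0 <= r < 1 ->
  (forall n, rnorm (u n.+1 - u n) <= (1 - r) * b * r ^+ n) ->
  exists l, forall n, rnorm (l - u n) <= b * r ^+ n.
Proof.
move=> r01 ub; have /andP[r0 r1] := r01.
have b0 : 0 <= b.
  have := le_trans (rnorm_ge0 _) (ub 0%N); rewrite expr0 mulr1 pmulr_rge0//.
  by rewrite subr_gt0.
have step n k : rnorm (u (n + k)%N - u n) <= b * r ^+ n - b * r ^+ (n + k).
  elim: k => [|k IH]; first by rewrite addn0 !subrr rnorm0.
  rewrite addnS -(subrKA (u (n + k)%N)).
  apply: le_trans (ler_rnormD _ _) _; have := ub (n + k)%N.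
  by rewrite exprS; lra.
have tail n k : rnorm (u (n + k)%N - u n) <= b * r ^+ n.
  apply: le_trans (step n k) _; rewrite gerBl mulr_ge0// exprn_ge0//.
have : cvg (u @ \oo)%classic.
  apply: cauchy_cvg; apply/cauchy_exP => e /posC_real[d d0 ->].
  have [n bn] := geometric_lt b r01 d0.
  exists (u n); exists n => // m /= nm.
  rewrite -ball_normE /= rnormE ltcR rnormB -(subnKC nm).
  exact: le_lt_trans (tail _ _) bn.
move=> /cvg_ex[/= l ul]; exists l => n; apply/ler_addgt0Pr => e e0.
have : nbhs l [set y | rnorm (l - y) < e]%classic by apply/nbhs_rnormP; exists e.
move=> /ul[m _ /(_ (n + m)%N (leq_addl _ _))] /= lm.
rewrite -(subrKA (u (n + m)%N)) addrC.
apply: le_trans (ler_rnormD _ _) _; apply: lerD; first exact: tail.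
exact: ltW.
Qed.

Section Continuity.
Context {X : normedModType R[i]} {U : topologicalType}.

Lemma uniform_approx_continuous (f : U -> X) :
  (forall e : R, 0 < e -> exists2 g : U -> X,
     continuous g & forall x, rnorm (f x - g x) <= e) ->
  continuous f.
Proof.
move=> fg x A /nbhs_rnormP[e e0 eA].
have e40 : 0 < e / 4 by rewrite divr_gt0.
have [g gc ge] := fg _ e40.
have : nbhs (g x) [set y | rnorm (g x - y) < e / 4]%classic.
  by apply/nbhs_rnormP; exists (e / 4).
move=> /gc; rewrite /nbhs /=; apply: filterS => y /= gxy; apply: eA.
have -> : f x - f y = (f x - g x) + (g x - g y) - (f y - g y).
  by rewrite addrA subrK opprB addrA subrK.
apply: le_lt_trans (ler_rnormB _ _) _.
have := ler_rnormD (f x - g x) (g x - g y).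
have := ge x; have := ge y; lra.
Qed.

Lemma rnorm_lipschitz_continuous (Y : normedModType R[i]) (f : Y -> X) (k : R) :
  (forall x y, rnorm (f x - f y) <= k * rnorm (x - y)) -> continuous f.
Proof.
move=> fk x A /nbhs_rnormP[e e0 eA]; apply/nbhs_rnormP.
have k0 : 0 < `|k| + 1 by rewrite ltr_wpDl.
exists (e / (`|k| + 1)); first by rewrite divr_gt0.
move=> y; rewrite ltr_pdivlMr// => xy; apply: eA.
apply: le_lt_trans (fk _ _) _; apply: le_lt_trans xy.
rewrite mulrC ler_wpM2l ?rnorm_ge0//.
by rewrite (le_trans (ler_norm k))// lerDl.
Qed.

End Continuity.

Lemma bounded_operator_bound (X : normedModType R[i]) (T : bounded_operator X) :
  exists2 b : R, 0 < b & forall x, rnorm (T x) <= b * rnorm x.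
Proof.
have [k /posC_real[b b0 ->] Tb] := linear_lipschitz (@op_continuous _ _ T).
by exists b => // x; move: (Tb x); rewrite !rnormE -rmorphM lecR.
Qed.

(** The contraction principle in the space of functions bounded by [b]: the
    iterates from 0 converge uniformly at rate 2^-n, so the fixed point inherits
    continuity.  It yields both the inverse of a perturbed operator and the
    semiconjugacy psi. *)
Lemma bounded_fixed_point (U : topologicalType) (X : completeNormedModType R[i])
    (F : (U -> X) -> U -> X) (b : R) :
  0 <= b ->
  (forall f, (forall x, rnorm (f x) <= b) -> forall x, rnorm (F f x) <= b) ->
  (forall f g d, (forall x, rnorm (f x) <= b) -> (forall x, rnorm (g x) <= b) ->
    (forall x, rnorm (f x - g x) <= d) ->
    forall x, rnorm (F f x - F g x) <= 2^-1 * d) ->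
  (forall f, (forall x, rnorm (f x) <= b) -> continuous f -> continuous (F f)) ->
  exists f, [/\ forall x, rnorm (f x) <= b, continuous f & F f =1 f].
Proof.
move=> b0 Fb Fd Fc; pose u n := iter n F (fun=> 0).
have r01 : 0 <= (2^-1 : R) < 1 by lra.
have ub n x : rnorm (u n x) <= b.
  elim: n x => [|n IH] x; first by rewrite /= rnorm0.
  exact: Fb.
have uc n : continuous (u n).
  elim: n => [|n IH]; first by move=> x; exact: cvg_cst.
  exact: Fc.
have ud n x : rnorm (u n.+1 x - u n x) <= (1 - 2^-1) * (2 * b) * 2^-1 ^+ n.
  have -> : (1 - 2^-1) * (2 * b) = b by field.
  elim: n x => [|n IH] x; first by rewrite /= subr0 mulr1; exact: (ub 1%N).
  by rewrite exprS mulrCA; exact: (Fd _ _ _ (ub n.+1) (ub n) IH x).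
have /choice[f fP] x := geometric_limit r01 (ud ^~ x).
have fb x : rnorm (f x) <= b.
  rewrite -subr_le0; apply: (le0_geometric (b := 2 * b) r01) => n.
  have := ler_rnormD (f x - u n x) (u n x); rewrite subrK.
  have := fP x n; have := ub n x; lra.
exists f; split=> //.
  apply: uniform_approx_continuous => e e0.
  have [n bn] := geometric_lt (2 * b) r01 e0.
  by exists (u n) => // x; exact: le_trans (fP x n) (ltW bn).
move=> x; apply/eqP; rewrite -subr_eq0; apply/eqP.
apply: (rnorm_geometric_eq0 (b := 2 * b) r01) => n.
have -> : F f x - f x = (F f x - F (u n) x) - (f x - u n.+1 x).
  by rewrite opprB addrA subrK.
apply: le_trans (ler_rnormB _ _) _.
have := Fd f (u n) (2 * b * 2^-1 ^+ n) fb (ub n) (fP ^~ n) x.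
by have := fP x n.+1; rewrite exprS; lra.
Qed.

End Limits.

(** * The Green operator of a splitting *)

Lemma subr_interchange (V : zmodType) (a b c d : V) :
  a - b - (c - d) = (a - c) - (b - d).
Proof. by rewrite !opprD addrACA. Qed.

Section Green.
Context {R : realType} {X : completeNormedModType R[i]}.
Implicit Types (x y l : X) (z : int -> X).

(** Hyperbolicity is the case where [P] is a projection commuting with [T].
    The decay of these two families is what makes the Green series converge, and
    its shift identity holds for every additive [P].  For a shift whose orbits
    grow up to some time and decay afterwards the range of [P] is invariant
    forward in time but not backward, and nonzero bounded orbits exist. *)
Record splitting (T : invertible_operator X) (P : X -> X) (C r : R) : Prop := {
  splitting_const : 0 <= C;
  splitting_rate : 0 <= r < 1;
  splittingB : forall x y, P (x - y) = P x - P y;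
  splitting_forward : forall n x,
    rnorm (iter n T (P x)) <= C * r ^+ n * rnorm x;
  splitting_backward : forall n x,
    rnorm (iter n (iop_inv T) (x - P x)) <= C * r ^+ n * rnorm x
}.

Lemma bounded_operatorB (L : bounded_operator X) x y : L (x - y) = L x - L y.
Proof. exact: raddfB. Qed.

Lemma bounded_operatorD (L : bounded_operator X) x y : L (x + y) = L x + L y.
Proof. exact: raddfD. Qed.

Lemma iter_linearB (L : bounded_operator X) n x y :
  iter n L (x - y) = iter n L x - iter n L y.
Proof. by elim: n => [//|n IH]; rewrite !iterS IH bounded_operatorB. Qed.

Lemma iter_continuous (L : X -> X) n : continuous L -> continuous (iter n L).
Proof.
move=> Lc; elim: n => [|n IH] x; first exact: cvg_id.
by apply: (continuous_comp (IH x)); exact: Lc.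
Qed.

Context (T : invertible_operator X) (P : X -> X) (C r : R).
Hypothesis TP : splitting T P C r.

Definition green_term z (k : nat) : X :=
  iter k T (P (z (Negz k))) - iter k.+1 (iop_inv T) (z k - P (z k)).

Definition green_sum z n : X := \sum_(k < n) green_term z k.

(** The limit is characterized by geometric convergence, so that identities
    between limits reduce to estimates on partial sums by [is_green_unique]. *)
Definition is_green z l : Prop :=
  exists b : R, forall n, rnorm (l - green_sum z n) <= b * r ^+ n.

Definition green z : X := xget 0 [set l | is_green z l]%classic.

Lemma green_sumS z n : green_sum z n.+1 = green_sum z n + green_term z n.
Proof. by rewrite /green_sum big_ord_recr. Qed.

Lemma green_sumB z z' n :
  green_sum (fun k => z k - z' k) n = green_sum z n - green_sum z' n.
Proof.
rewrite /green_sum -sumrB; apply: eq_bigr => k _; rewrite /green_term.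
rewrite !(splittingB TP) !iter_linearB [RHS]subr_interchange.
by congr (_ - _); exact: subr_interchange.
Qed.

Lemma is_green_unique z l l' : is_green z l -> is_green z l' -> l = l'.
Proof.
move=> [b lb] [b' lb']; apply/eqP; rewrite -subr_eq0; apply/eqP.
apply: (rnorm_geometric_eq0 (splitting_rate TP) (b := b + b')) => n.
rewrite -(subrKA (green_sum z n)) mulrDl.
by rewrite (le_trans (ler_rnormD _ _))// lerD// rnormB.
Qed.

Lemma green_eq z l : is_green z l -> green z = l.
Proof.
move=> zl; rewrite /green; case: xgetP => [l' _ /is_green_unique|/(_ l)//].
exact.
Qed.

(** Twice the sum of C r^n over n, one for each half of the series. *)
Definition green_bound : R := 2 * C / (1 - r).

Lemma green_tail z (b : R) : (forall k, rnorm (z k) <= b) ->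
  forall n, rnorm (green z - green_sum z n) <= green_bound * b * r ^+ n.
Proof.
move=> zb; have r01 := splitting_rate TP; have /andP[r0 r1] := r01.
suff [l lP] : exists l, forall n,
    rnorm (l - green_sum z n) <= green_bound * b * r ^+ n.
  by rewrite (green_eq (l := l))//; exists (green_bound * b).
apply: geometric_limit => // n; rewrite green_sumS addrAC subrr add0r.
have -> : (1 - r) * (green_bound * b) * r ^+ n = 2 * (C * b) * r ^+ n.
  by rewrite /green_bound; field; rewrite subr_eq0 eq_sym lt_eqF.
have C0 := splitting_const TP; have rn0 : 0 <= r ^+ n by exact: exprn_ge0.
apply: le_trans (ler_rnormB _ _) _.
have z1 := le_trans (splitting_forward TP n (z (Negz n)))
  (ler_wpM2l (mulr_ge0 C0 rn0) (zb (Negz n))).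
have z2 := le_trans (splitting_backward TP n.+1 (z n))
  (ler_wpM2l (mulr_ge0 C0 (exprn_ge0 n.+1 r0)) (zb n)).
have b0 : 0 <= b := le_trans (rnorm_ge0 _) (zb 0).
have : C * b * r ^+ n * r <= C * b * r ^+ n.
  by apply: ler_piMr; [rewrite !mulr_ge0|exact: ltW].
by move=> h; apply: le_trans (lerD z1 z2) _; rewrite exprS; lra.
Qed.

Lemma green_le z (b : R) : (forall k, rnorm (z k) <= b) ->
  rnorm (green z) <= green_bound * b.
Proof.
move=> /green_tail /(_ 0%N).
by rewrite /green_sum big_ord0 subr0 mulr1.
Qed.

Lemma greenB z z' (b b' : R) :
  (forall k, rnorm (z k) <= b) -> (forall k, rnorm (z' k) <= b') ->
  green (fun k => z k - z' k) = green z - green z'.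
Proof.
move=> /green_tail zb /green_tail zb'; apply: green_eq.
exists (green_bound * b + green_bound * b') => n.
rewrite green_sumB subr_interchange mulrDl.
by rewrite (le_trans (ler_rnormB _ _))// lerD.
Qed.

(** Applying [T] to the partial sum and comparing with the sum of the shifted
    sequence telescopes; the two remaining terms are of order r^n. *)
Lemma green_sum_shift z n :
  T (green_sum z n) + z 0 - green_sum (fun k => z (k + 1)) n =
  iter n T (P (z (- n%:Z))) + iter n (iop_inv T) (z n - P (z n)).
Proof.
elim: n => [|n IH].
  by rewrite /green_sum !big_ord0 raddf0 add0r !subr0 /= addrC subrK.
have -> : - n.+1%:Z = Negz n by rewrite NegzE.
rewrite !green_sumS bounded_operatorD [_ + z 0]addrAC opprD addrACA IH.
rewrite /green_term bounded_operatorB !iterS iop_invK.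
have -> : Negz n + 1 = - n%:Z by rewrite NegzE -addn1 PoszD opprD addrNK.
have -> : n%:Z + 1 = n.+1 by rewrite -addn1.
by rewrite opprB [X in _ + X]addrACA -opprD addrC [X in _ - X]addrC subrK.
Qed.

(** Applied to the translates of one sequence z, this says that the values
    y_n of [green] on them solve y_(n+1) = T y_n + z_n. *)
Lemma green_shift z (b : R) : (forall k, rnorm (z k) <= b) ->
  green (fun k => z (k + 1)) = T (green z) + z 0.
Proof.
move=> zb; have [t t0 Tt] := bounded_operator_bound T.
apply: green_eq; exists (t * (green_bound * b) + (C * b + C * b)) => n.
rewrite -(subrK (green_sum z n) (green z)) bounded_operatorD -addrA -addrA [X in _ + X]addrA.
rewrite green_sum_shift mulrDl; have [r0 r1] := andP (splitting_rate TP).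
have C0 : 0 <= C * r ^+ n by rewrite mulr_ge0 ?exprn_ge0// (splitting_const TP).
have z1 := le_trans (splitting_forward TP n (z (- n%:Z)))
  (ler_wpM2l C0 (zb _)).
have z2 := le_trans (splitting_backward TP n (z n)) (ler_wpM2l C0 (zb _)).
apply: le_trans (ler_rnormD _ _) _; apply: lerD.
  apply: le_trans (Tt _) _; rewrite -mulrA (ler_wpM2l (ltW t0))//.
  exact: green_tail.
by apply: le_trans (ler_rnormD _ _) _; rewrite mulrDl mulrAC; exact: lerD.
Qed.

(** A bounded family of sequences makes the series converge uniformly, and each
    partial sum depends on finitely many entries. *)
Lemma green_continuous (U : topologicalType) (h : U -> int -> X) (b : R) :
  (forall u k, rnorm (h u k) <= b) -> (forall k, continuous (h ^~ k)) ->
  continuous (fun u => green (h u)).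
Proof.
move=> hb hc; have Pc : continuous P.
  apply: (rnorm_lipschitz_continuous (k := C)) => x y.
  by have := splitting_forward TP 0 (x - y); rewrite (splittingB TP) mulr1.
apply: uniform_approx_continuous => e e0.
have [n ne] := geometric_lt (green_bound * b) (splitting_rate TP) e0.
exists (fun u => green_sum (h u) n); last first.
  by move=> u; exact: le_trans (green_tail (hb u) n) (ltW ne).
elim: n {ne} => [|n IH] u.
  rewrite (_ : (fun u => _) = fun=> 0); first exact: cvg_cst.
  by apply/funext => v; rewrite /green_sum big_ord0.
rewrite (_ : (fun u => _) = fun u => green_sum (h u) n + green_term (h u) n).
  apply: cvgD; first exact: IH.
  apply: cvgB.
    apply: (@continuous_comp _ _ _ (fun u => P (h u (Negz n)))).
      exact: continuous_comp (hc _ u) (Pc _).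
    exact/iter_continuous/op_continuous.
  apply: (@continuous_comp _ _ _ (fun u => h u n - P (h u n))).
    apply: cvgB; first exact: hc.
    exact: continuous_comp (hc _ u) (Pc _).
  exact/iter_continuous/op_continuous.
by apply/funext => v; rewrite green_sumS.
Qed.

End Green.

(** * Splittings give shadowing and strong structural stability *)

(** The integer iterates of [f] when [g] is its inverse; [op_iter] is the case of
    an invertible operator, by conversion. *)
Definition ziter (U : Type) (f g : U -> U) (n : int) (x : U) : U :=
  match n with Posz m => iter m f x | Negz m => iter m.+1 g x end.

Lemma ziterSr (U : Type) (f g : U -> U) n x : cancel f g ->
  ziter f g (n + 1) x = ziter f g n (f x).
Proof.
move=> fK; case: n => [n|[|n]].
- by rewrite -PoszD addn1 /= -iterSr.
- by rewrite /= fK.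
- have -> : Negz n.+1 + 1 = Negz n by rewrite !NegzE -[n.+2]addn1 PoszD opprD addrNK.
  by rewrite /ziter [in RHS]iterSr fK.
Qed.

Lemma ziter_conj {U V : Type} (f g : U -> U) (f' g' : V -> V) (h : U -> V) :
  cancel g f -> cancel f' g' -> (forall x, h (f x) = f' (h x)) ->
  forall n x, h (ziter f g n x) = ziter f' g' n (h x).
Proof.
move=> gK f'K hf; have hg x : h (g x) = g' (h x).
  by rewrite -{2}(gK x) hf f'K.
case=> n x; rewrite /ziter; last move: n.+1 => {}n.
all: by elim: n => [//|n IH]; rewrite !iterS ?hf ?hg IH.
Qed.

(** A two-sided orbit is the image of 0 under a map conjugating the successor of
    the integers to [f]. *)
Lemma ziter_orbit {U : Type} (f g : U -> U) (v : int -> U) :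
  cancel f g -> (forall n, v (n + 1) = f (v n)) ->
  forall n, ziter f g n (v 0) = v n.
Proof.
move=> fK vf n.
have := ziter_conj (g := fun n : int => n - 1) (fun n => subrK 1 n) fK vf n 0.
move=> <-; congr v; case: n => n; rewrite /ziter; last rewrite NegzE; last move: n.+1 => {}n.
all: by elim: n => [//|n IH]; rewrite iterS IH -addn1 PoszD ?opprD.
Qed.

Section SplittingConsequences.
Context {R : realType} {X : completeNormedModType R[i]}.
Context (T : invertible_operator X) (P : X -> X) (C r : R).
Hypothesis TP : splitting T P C r.

Let B : R := green_bound C r.

Lemma green_bound_ge0 : 0 <= green_bound C r.
Proof.
have /andP[_ r1] := splitting_rate TP; have C0 := splitting_const TP.
by rewrite divr_ge0 ?mulr_ge0// subr_ge0 ltW.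
Qed.

(** The correction y_n driven by the errors of the pseudotrajectory satisfies
    the same inhomogeneous equation, hence the difference is an orbit of [T]. *)
Lemma splitting_shadowing : shadowing_property T.
Proof.
have B0 : 0 <= B := green_bound_ge0.
have B1 : 0 < B + 1 by rewrite ltr_wpDl.
move=> e e0; exists (e / (B + 1)); first exact: divr_gt0.
move=> x xd; pose z n := x (n + 1) - T (x n).
have zd n : rnorm (z n) <= e / (B + 1) by rewrite rnormB; exact: xd.
pose y n := green T P r (fun k => z (n + k)).
have yS n : y (n + 1) = T (y n) + z n.
  rewrite -[in z n](addr0 n) -(green_shift TP (z := fun k => z (n + k)) (fun k => zd _)).
  by congr green; apply/funext => k; rewrite addrAC addrA.
exists (x 0 - y 0) => n.
have -> : op_iter T n (x 0 - y 0) = x n - y n.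
  apply: (ziter_orbit (f := T) (g := iop_inv T) (v := fun n => x n - y n)).
    exact: iopK.
  by move=> k /=; rewrite yS bounded_operatorB opprD addrA addrAC /z opprB addrCA subrr addr0.
rewrite addrAC subrr add0r rnormN.
apply: le_lt_trans (green_le TP (z := fun k => z (n + k)) (fun k => zd _)) _.
by rewrite mulrCA gtr_pMr// ltr_pdivrMr// mul1r ltrDl.
Qed.

(** Writing the inverse of T + a as T^-1 + h turns g = T^-1 (y - a (g y)) into a
    fixed point equation for the bounded map h. *)
Lemma perturbation_inverse (a : X -> X) (d k t : R) : 
  (forall x, rnorm (a x) <= d) ->
  (forall x y, rnorm (a x - a y) <= k * rnorm (x - y)) ->
  (forall x, rnorm (iop_inv T x) <= t * rnorm x) -> 0 <= t -> t * k <= 2^-1 ->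
  exists g : X -> X, [/\ continuous g, cancel (fun x => T x + a x) g &
    cancel g (fun x => T x + a x)].
Proof.
move=> ad ak Tt t0 tk; have ac := rnorm_lipschitz_continuous ak.
have d0 : 0 <= d := le_trans (rnorm_ge0 _) (ad 0).
pose F (h : X -> X) y := - iop_inv T (a (iop_inv T y + h y)).
have Fb h : (forall y, rnorm (h y) <= t * d) -> forall y, rnorm (F h y) <= t * d.
  by move=> _ y; rewrite /F rnormN (le_trans (Tt _))// ler_wpM2l.
have Fd h h' e : (forall y, rnorm (h y) <= t * d) -> (forall y, rnorm (h' y) <= t * d) ->
    (forall y, rnorm (h y - h' y) <= e) -> forall y, rnorm (F h y - F h' y) <= 2^-1 * e.
  move=> _ _ he y; have e0 : 0 <= e := le_trans (rnorm_ge0 _) (he y).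
  rewrite /F opprK addrC -bounded_operatorB; apply: le_trans (Tt _) _.
  apply: le_trans (ler_wpM2l t0 (ak _ _)) _.
  rewrite opprD addrACA subrr add0r mulrA rnormB.
  apply: le_trans (ler_wpM2r (rnorm_ge0 _) tk) _.
  by rewrite ler_wpM2l// invr_ge0.
have Fc h : (forall y, rnorm (h y) <= t * d) -> continuous h -> continuous (F h).
  move=> _ hc y; apply: cvgN.
  apply: (@continuous_comp _ _ _ (fun y => a (iop_inv T y + h y))).
    apply: (@continuous_comp _ _ _ (fun y => iop_inv T y + h y)).
      by apply: cvgD; [exact: op_continuous|exact: hc].
    exact: ac.
  exact: op_continuous.
have [h [hb hc hF]] := bounded_fixed_point (mulr_ge0 t0 d0) Fb Fd Fc.
pose S x := T x + a x; pose g y := iop_inv T y + h y.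
have gK : cancel g S.
  move=> y; have gE : g y = iop_inv T (y - a (g y)).
    by rewrite bounded_operatorB {1}/g -(hF y).
  by rewrite /S {1}gE iop_invK subrK.
have S_inj : injective S.
  move=> x y Sxy; apply/eqP; rewrite -subr_eq0; apply/eqP/rnorm0_eq0.
  apply/eqP; rewrite eq_le rnorm_ge0 andbT.
  have aE : T (x - y) = a y - a x.
    by apply/eqP; rewrite bounded_operatorB subr_eq addrAC eq_sym subr_eq -/(S x) Sxy addrC.
  have := Tt (T (x - y)); rewrite iopK aE.
  move=> /le_trans /(_ (ler_wpM2l t0 (ak _ _))); rewrite rnormB mulrA => xy.
  have := le_trans xy (ler_wpM2r (rnorm_ge0 _) tk); lra.
exists g; split=> //; last by move=> x; apply: S_inj; rewrite gK.
by move=> y; apply: cvgD; [exact: op_continuous|exact: hc].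
Qed.

(** With G the Green operator, phi x = - G (a (S^k x))_k and psi solves
    psi x = G (a (T^k x + psi (T^k x)))_k.  Then H = I + phi and K = I + psi satisfy
    H S = T H and K T = S K, and H K = I because transporting the orbit of S
    through K turns the formula for phi into minus the one for psi.  For K H the
    same substitution bounds the displacement K H - I by half of its own
    supremum. *)
Lemma stable_of_splitting : strongly_structurally_stable T.
Proof.
have B0 : 0 <= B := green_bound_ge0.
move=> e e0; have [t t0 Tt] := bounded_operator_bound (iop_inv T).
(* The three bounds give, in order: |phi| <= e, the contraction factor 1/2 of
   the equation for psi, and the invertibility of T + a. *)
pose d := Num.min (e / (B + 1)) (Num.min (4^-1 / (B + 1)) (4^-1 / t)).
have d0 : 0 < d by rewrite !lt_min !divr_gt0// ltr_wpDl.
have Bd : B * d <= e.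
  apply: (@le_trans _ _ (B * (e / (B + 1)))).
    by rewrite ler_wpM2l// ge_min lexx.
  rewrite mulrCA ger_pMr// ler_pdivrMr ?ltr_wpDl// mul1r; lra.
have Bd2 : B * (2 * d) <= 2^-1.
  have : d <= 4^-1 / (B + 1) by rewrite !ge_min lexx orbT.
  rewrite ler_pdivlMr ?ltr_wpDl//; lra.
have td2 : t * (2 * d) <= 2^-1.
  have : d <= 4^-1 / t by rewrite !ge_min lexx !orbT.
  rewrite ler_pdivlMr//; lra.
have d20 : 0 <= 2 * d by rewrite mulr_ge0 ?(ltW d0).
exists d => // a _ ad' aL'.
have ad x : rnorm (a x) <= d.
  by rewrite -lee_fin (le_trans _ ad')//; apply: ereal_sup_ubound; exists x.
(* The best Lipschitz constant is an infimum; 2 d exceeds it, hence is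
   itself a Lipschitz constant. *)
have ak x y : rnorm (a x - a y) <= 2 * d * rnorm (x - y).
  have : (lipschitz_constant a < (2 * d)%:E)%E.
    by apply: le_lt_trans aL' _; rewrite lte_fin; lra.
  move=> /ereal_inf_lt[_ [k [k0 ka] <-]]; rewrite lte_fin => kd.
  have := ka (x, y) (conj I I); rewrite /= !rnormE -rmorphM lecR => /le_trans.
  by apply; rewrite ler_wpM2r ?rnorm_ge0// ltW.
have ac := rnorm_lipschitz_continuous ak.
have [g [gc Sg gS]] := perturbation_inverse ad ak Tt (ltW t0) td2.
pose S x := T x + a x; pose G z := green T P r z.
have SK : cancel S g by [].
have Tc n : continuous (ziter T (iop_inv T) n).
  by case: n => n; apply: iter_continuous; exact: op_continuous.
have Sc : continuous S by move=> x; apply: cvgD; [exact: op_continuous|exact: ac].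
have Snc n : continuous (ziter S g n).
  by case: n => n; exact: iter_continuous.
pose phi x := - G (fun n => a (ziter S g n x)).
have phiS x : phi (S x) = T (phi x) - a x.
  have := green_shift TP (z := fun n => a (ziter S g n x)) (fun n => ad _).
  rewrite /phi raddfN /= -opprD => <-; congr (- G _); apply/funext => n.
  by rewrite ziterSr.
have phie x : rnorm (phi x) <= e.
  by rewrite rnormN; apply: le_trans Bd; exact: green_le.
have phic : continuous phi.
  move=> x; apply: cvgN.
  apply: (green_continuous TP (h := fun x n => a (ziter S g n x)) (b := d)) => // n.
  by move=> y; apply: continuous_comp; [exact: Snc|exact: ac].
pose F h x := G (fun n => a (ziter T (iop_inv T) n x + h (ziter T (iop_inv T) n x))).
have Fe h : (forall x, rnorm (h x) <= e) -> forall x, rnorm (F h x) <= e.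
  by move=> _ x; apply: le_trans Bd; exact: green_le.
have Fd h h' b : (forall x, rnorm (h x) <= e) -> (forall x, rnorm (h' x) <= e) ->
    (forall x, rnorm (h x - h' x) <= b) -> forall x, rnorm (F h x - F h' x) <= 2^-1 * b.
  move=> _ _ hb x; have b0 : 0 <= b := le_trans (rnorm_ge0 _) (hb x).
  rewrite -(greenB TP (fun n => ad _) (fun n => ad _)).
  apply: le_trans (green_le TP (b := 2 * d * b) _) _.
    move=> n; apply: le_trans (ak _ _) _.
    by apply: (ler_wpM2l d20); rewrite opprD addrACA subrr add0r; exact: hb.
  by rewrite mulrA ler_wpM2r.
have Fc h : (forall x, rnorm (h x) <= e) -> continuous h -> continuous (F h).
  move=> _ hc; apply: (green_continuous TP (h := fun x n =>
    a (ziter T (iop_inv T) n x + h (ziter T (iop_inv T) n x))) (b := d)) => // n y.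
  apply: (@continuous_comp _ _ _ (fun y =>
    ziter T (iop_inv T) n y + h (ziter T (iop_inv T) n y))); last exact: ac.
  by apply: cvgD; [exact: Tc|apply: continuous_comp; [exact: Tc|exact: hc]].
have [psi [psie psic psiF]] := bounded_fixed_point (ltW e0) Fe Fd Fc.
pose H x := x + phi x; pose K x := x + psi x.
have HS x : H (S x) = T (H x).
  by rewrite /H phiS bounded_operatorD /S addrACA subrr addr0.
have KT x : K (T x) = S (K x).
  rewrite /K -(psiF (T x)) /S bounded_operatorD.
  pose z n := a (K (ziter T (iop_inv T) n x)).
  have psiT : G (fun n => z (n + 1)) = T (psi x) + a (K x).
    by rewrite -(psiF x); exact: (green_shift TP (z := z) (fun n => ad _)).
  rewrite -addrA -psiT; congr (_ + G _); apply/funext => n.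
  by rewrite /z ziterSr//; exact: iopK.
have HnS := ziter_conj gS (@iopK _ _ T) HS.
have KnT := ziter_conj (@iop_invK _ _ T) SK KT.
have KK x : H (K x) = x.
  rewrite /H /phi; under eq_fun do rewrite -KnT.
  by rewrite -/(F psi x) psiF /K addrK.
have HK x : K (H x) = x.
  have KHx y : K (H y) - y = phi y + psi (H y) by rewrite /K addrAC {1}/H [y + _]addrC addrK.
  have KHd n y : rnorm (K (H y) - y) <= 2 * e * 2^-1 ^+ n.
    elim: n y => [|n IH] y.
      rewrite mulr1 KHx; apply: le_trans (ler_rnormD _ _) _.
      by rewrite mulr_natl mulr2n lerD.
    rewrite KHx addrC -psiF /F /phi.
    rewrite -(greenB TP (fun n => ad _) (fun n => ad _)).
    apply: le_trans (green_le TP (b := 2 * d * (2 * e * 2^-1 ^+ n)) _) _.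
      move=> m; apply: le_trans (ak _ _) _.
      apply: (ler_wpM2l d20).
      by rewrite -HnS; exact: IH.
    rewrite mulrA exprS [leRHS]mulrCA ler_wpM2r//.
    by rewrite mulr_ge0 ?exprn_ge0 ?invr_ge0// mulr_ge0// ltW.
  apply/eqP; rewrite -subr_eq0; apply/eqP.
  by apply: (rnorm_geometric_eq0 (r := 2^-1) (b := 2 * e)) => //; lra.
exists phi; split.
- by apply: ge_ereal_sup => _ [x _ <-]; rewrite lee_fin.
- split; first by move=> x; apply: cvgD; [exact: cvg_id|exact: phic].
  by exists K; split=> // x; apply: cvgD; [exact: cvg_id|exact: psic].
- by apply/funext => x /=; rewrite -HS.
Qed.

End SplittingConsequences.

(** * Bounded solutions force a dichotomy of the weights *)

Section Dichotomy.
Context {R : realType} (w : int -> R).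
Hypothesis w_gt0 : forall n, 0 < w n.

(** Down from position [k]: the n-th iterate of the shift moves the entry at k to
    k - n and multiplies it by [wprod k n]. *)
Definition wprod (k : int) (n : nat) : R := \prod_(i < n) w (k - i%:Z).

Lemma wprod_gt0 k n : 0 < wprod k n.
Proof. by apply: prodr_gt0 => i _. Qed.

Lemma wprod0 k : wprod k 0 = 1.
Proof. by rewrite /wprod big_ord0. Qed.

Lemma wprodSr k n : wprod k n.+1 = wprod k n * w (k - n%:Z).
Proof. by rewrite /wprod big_ord_recr. Qed.

Lemma wprodSl k n : wprod k n.+1 = w k * wprod (k - 1) n.
Proof.
rewrite /wprod big_ord_recl subr0; congr (_ * _); apply: eq_bigr => i _.
by congr (w _); rewrite /= /bump /=; lia.
Qed.

(** The segments are finite because a single perturbation with a small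
    Lipschitz constant can prescribe the forcing along finitely many points. *)
Definition bounded_forcing (K : R) : Prop := forall (j : int) (L : nat),
  exists a : nat -> R, (forall i, (i <= L)%N -> `|a i| <= K) /\
    (forall i, (i < L)%N -> a i.+1 = w (j - i%:Z) * a i + 1).

Section Segment.
Context (K : R) (K0 : 0 < K) (j : int) (L : nat) (a : nat -> R).
Hypothesis aK : forall i, (i <= L)%N -> `|a i| <= K.
Hypothesis aS : forall i, (i < L)%N -> a i.+1 = w (j - i%:Z) * a i + 1.

Let r := K / (K + 1).

Let r0 : 0 < r. Proof. by rewrite divr_gt0// addr_gt0. Qed.

Let r1 : r < 1. Proof. by rewrite ltr_pdivrMr ?addr_gt0// mul1r ltrDl. Qed.

Let rK : r * (K + 1) = K.
Proof. by rewrite divfK// gt_eqF// addr_gt0. Qed.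

(** From w a_i = a_(i+1) - 1 and a_(i+1) <= K one gets
    w a_i <= (1 - 1/(K+1)) a_(i+1): the weights contract by r = K/(K+1), relative
    to [a], as long as [a] is positive; and then [a] never drops below 1. *)
Lemma segment_above1 i n : 1 <= a i -> (i + n <= L)%N ->
  1 <= a (i + n)%N /\ wprod (j - i%:Z) n * a i <= r ^+ n * a (i + n)%N.
Proof.
move=> ai; elim: n => [|n IH] inL.
  by rewrite addn0 wprod0 expr0 !mul1r lexx.
rewrite addnS in inL *; have [a1 an] := IH (ltnW inL).
have aE := aS inL; have aSK : a (i + n).+1 <= K by exact: le_trans (ler_norm _) (aK inL).
have w0 := w_gt0 (j - (i + n)%N%:Z).
split; first by rewrite aE lerDr mulr_ge0 ?ltW//; lra.
have -> : wprod (j - i%:Z) n.+1 = wprod (j - i%:Z) n * w (j - (i + n)%N%:Z).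
  by rewrite wprodSr; congr (_ * w _); lia.
rewrite mulrAC; apply: le_trans (ler_wpM2r (ltW w0) an) _.
rewrite exprSr -mulrA -mulrA ler_wpM2l ?exprn_ge0 ?(ltW r0)//.
have -> : a (i + n)%N * w (j - (i + n)%N%:Z) = a (i + n).+1 - 1 by rewrite aE; ring.
have : 0 <= (1 - r) * (K + 1 - a (i + n).+1) by rewrite mulr_ge0 ?subr_ge0 ?(ltW r1)//; lra.
have := rK; lra.
Qed.

(** The mirror image: for s = - a > 0, w s_i = s_(i+1) + 1 and s_(i+1) <= K give
    s_(i+1) <= r w s_i; and negativity propagates backwards. *)
Lemma segment_below0 i n : (i + n <= L)%N -> a (i + n)%N < 0 ->
  a i < 0 /\ - a (i + n)%N <= r ^+ n * (wprod (j - i%:Z) n * - a i).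
Proof.
elim: n => [|n IH] inL; first by rewrite addn0 wprod0 expr0 !mul1r.
rewrite addnS in inL * => an; have aE := aS inL.
have w0 := w_gt0 (j - (i + n)%N%:Z).
have wa : w (j - (i + n)%N%:Z) * a (i + n)%N < 0 by lra.
have [|ai ain] := IH (ltnW inL); first by rewrite -(pmulr_rlt0 _ w0).
split=> //.
have -> : wprod (j - i%:Z) n.+1 = wprod (j - i%:Z) n * w (j - (i + n)%N%:Z).
  by rewrite wprodSr; congr (_ * w _); lia.
have aSK : - a (i + n).+1 <= K.
  by rewrite (le_trans _ (aK inL))// -normrN ler_norm.
apply: (@le_trans _ _ (r * w (j - (i + n)%N%:Z) * - a (i + n)%N)).
  have : 0 <= (1 - r) * (K + a (i + n).+1) by rewrite mulr_ge0 ?subr_ge0 ?(ltW r1)//; lra.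
  have -> : r * w (j - (i + n)%N%:Z) * - a (i + n)%N = r * (1 - a (i + n).+1).
    by rewrite aE; ring.
  have := rK; lra.
apply: le_trans (ler_wpM2l (mulr_ge0 (ltW r0) (ltW w0)) ain) _.
by rewrite exprS le_eqVlt; apply/orP; left; apply/eqP; ring.
Qed.

End Segment.

(** On the segment of positions from N down to -N, cut along the sign of a
    bounded solution.  Each product involves finitely many positions, so an
    estimate that holds for the cut of the N-th segment, for ultrafilter-many N,
    holds for the limit cut [D].  The proof of each estimate loses one step: a
    nonnegative entry is only followed by one above 1, and a negative one only
    preceded by one whose image has modulus at least 1. *)
Lemma wprod_dichotomy (K W : R) : 0 < K -> (forall k, w k <= W) ->
  bounded_forcing K ->
  exists (D : set int) (C r : R), [/\ 0 <= C, 0 <= r < 1,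
    forall k n, ~ D k -> wprod k n <= C * r ^+ n &
    forall k n, D k -> 1 <= C * r ^+ n * wprod (k + n%:Z) n].
Proof.
move=> K0 wW bf; pose r := K / (K + 1).
have r0 : 0 < r by rewrite divr_gt0// addr_gt0.
have r1 : r < 1 by rewrite ltr_pdivrMr ?addr_gt0// mul1r ltrDl.
have W0 : 0 < W := lt_le_trans (w_gt0 0) (wW 0).
pose C := 1 + W * K / r + K / r.
have Kr : 0 <= K / r by rewrite divr_ge0 ?ltW.
have WKr : 0 <= W * K / r by rewrite -mulrA mulr_ge0 // ltW.
have C1 : 1 <= C by rewrite /C -addrA lerDl addr_ge0.
have /choice[a aP] := fun N : nat => bf N%:Z (N + N)%N.
have [U [UU NU]] := ultraFilterLemma eventually_filter.
have UN M : U [set N : nat | (M <= N)%N]%classic by apply: NU; exists M.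
(* Position k is reached at time N - k. *)
pose below k := [set N : nat | a N `|N%:Z - k|%N < 0]%classic.
exists [set k | U (below k)]%classic, C, r; split.
- lra.
- by rewrite (ltW r0).
- move=> k n UDk.
  have [//|{}UDk] := in_ultra_setVsetC (below k) UU.
  have [N [/= /negP]] := filter_ex (filterI UDk (UN (`|k| + n)%N)).
  rewrite -leNgt => aNk kN; move: (a N) (aP N) aNk => b [aK aS] aNk.
  set i := `|N%:Z - k|%N in aNk; have ik : N%:Z - i%:Z = k by rewrite /i; lia.
  case: n kN => [|n] kN; first by rewrite wprod0 mulr1.
  have iL : (i < N + N)%N by rewrite /i; lia.
  have a1 : 1 <= b i.+1 by rewrite aS// lerDr mulr_ge0// ltW.
  have inL : (i.+1 + n <= N + N)%N by rewrite /i; lia.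
  have [_] := segment_above1 K0 aK aS a1 inL.
  have -> : N%:Z - i.+1%:Z = k - 1 by rewrite -ik; lia.
  move=> an; have an1 : wprod (k - 1) n <= r ^+ n * K.
    apply: (@le_trans _ _ (wprod (k - 1) n * b i.+1)).
      by rewrite ler_peMr// ltW// wprod_gt0.
    apply: le_trans an _; rewrite ler_wpM2l ?exprn_ge0 ?(ltW r0)//.
    exact: le_trans (ler_norm _) (aK _ inL).
  rewrite wprodSl; apply: (@le_trans _ _ (W * (r ^+ n * K))).
    by apply: ler_pM => //; rewrite ltW// wprod_gt0.
  have -> : W * (r ^+ n * K) = W * K / r * r ^+ n.+1.
    by rewrite exprS; field; rewrite gt_eqF.
  by rewrite ler_wpM2r ?exprn_ge0 ?(ltW r0)// /C; lra.
- move=> k n UDk.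
  have [N []] := filter_ex (filterI UDk (UN (`|k| + n)%N)).
  rewrite /below /= => aNk kN.
  move: (a N) (aP N) aNk => b [aK aS] aNk.
  case: n kN => [|n] kN; first by rewrite wprod0 !mulr1.
  set i := `|(N%:Z - k - n.+1%:Z)%R|%N.
  have ik : N%:Z - i%:Z = k + n.+1%:Z by rewrite /i; lia.
  have iL : (i <= N + N)%N by rewrite /i; lia.
  have iE : `|N%:Z - k|%N = (i + n).+1 by rewrite /i; lia.
  rewrite iE in aNk; have inL : (i + n < N + N)%N by rewrite /i; lia.
  have aE := aS _ inL; have w0 := w_gt0 (N%:Z - (i + n)%N%:Z).
  have wa : w (N%:Z - (i + n)%N%:Z) * b (i + n)%N < 0 by lra.
  have an0 : b (i + n)%N < 0 by rewrite -(pmulr_rlt0 _ w0).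
  have [ai ain] := segment_below0 K0 aK aS (ltnW inL) an0.
  have aiK : - b i <= K.
    by apply: le_trans (aK i iL); rewrite -normrN ler_norm.
  have : 1 <= w (N%:Z - (i + n)%N%:Z) * - b (i + n)%N by lra.
  move=> /le_trans /(_ (ler_wpM2l (ltW w0) ain)) h; apply: le_trans h _.
  have -> : w (N%:Z - (i + n)%N%:Z) * (r ^+ n * (wprod (N%:Z - i%:Z) n * - b i)) =
      r ^+ n * wprod (N%:Z - i%:Z) n.+1 * - b i.
    by rewrite wprodSr PoszD opprD addrA; ring.
  rewrite ik; set p := wprod _ _; have p0 : 0 <= p by rewrite ltW// wprod_gt0.
  have rp0 : 0 <= r ^+ n * p by rewrite mulr_ge0// exprn_ge0// ltW.
  apply: le_trans (ler_wpM2l rp0 aiK) _.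
  have -> : r ^+ n * p * K = K / r * r ^+ n.+1 * p.
    by rewrite exprS; field; rewrite gt_eqF.
  by rewrite ler_wpM2r// ler_wpM2r ?exprn_ge0 ?(ltW r0)// /C; lra.
Qed.

End Dichotomy.

(** * Weighted shifts on solid translation-invariant sequence spaces *)

Section SequenceSpaces.
Context {R : realType}.

(** [coord_dominated] says at once that the space is solid and that translations
    act on it isometrically.  Hence every bounded combination of a diagonal
    operator and a translation, such as T^n P, acts on the space with the norm
    bound read off from its coefficients. *)
Record sequence_space (X : normedModType R[i]) (c : X -> int -> R[i]) : Prop := {
  coordD : forall x y n, c (x + y) n = c x n + c y n;
  coord_inj : injective c;
  coord_le : forall x n, rnorm (c x n) <= rnorm x;
  coord_dominated : forall (M : R) x (k : int) (y : int -> R[i]), 0 <= M ->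
    (forall n, rnorm (y n) <= M * rnorm (c x (n + k))) ->
    exists2 x', c x' = y & rnorm x' <= M * rnorm x;
  coord_nontrivial : exists x, c x 0 != 0
}.

Lemma rnorm_real (a : R) : rnorm (a%:C%C : R[i]) = `|a|.
Proof. by rewrite /rnorm normc_def /= expr0n /= addr0 sqrtr_sqr. Qed.

Lemma ler_Re_rnorm (z : R[i]) : `|complex.Re z| <= rnorm z.
Proof. by rewrite -lecR -rnormE normc_ge_Re. Qed.

Lemma Re_realM (a : R) (z : R[i]) : complex.Re (a%:C%C * z) = a * complex.Re z.
Proof. by case: z => u v /=; rewrite mul0r subr0. Qed.

Context {X : completeNormedModType R[i]} (c : X -> int -> R[i]).
Hypothesis cX : sequence_space c.

Lemma coord0 n : c 0 n = 0.
Proof. by apply: (addrI (c 0 n)); rewrite -(coordD cX) !addr0. Qed.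

Lemma coordB x y n : c (x - y) n = c x n - c y n.
Proof. by apply/eqP; rewrite eq_sym subr_eq -(coordD cX) subrK. Qed.

Lemma coord_norm_dominated (M : R) (x x' : X) (k : int) : 0 <= M ->
  (forall n, rnorm (c x' n) <= M * rnorm (c x (n + k))) ->
  rnorm x' <= M * rnorm x.
Proof.
by move=> M0 xx'; have [x'' /(coord_inj cX) ->] := coord_dominated cX M0 xx'.
Qed.

(** [ev k a] is a times the basis vector at position k; an element
    whose entry at 0 is nonzero dominates it after a translation. *)
Lemma unit_vectors : exists (E : R) (ev : int -> R -> X), [/\ 0 < E,
  forall k a n, c (ev k a) n = if n == k then a%:C%C else 0 &
  forall k a, rnorm (ev k a) <= E * `|a|].
Proof.
have [x x0] := coord_nontrivial cX; set b := rnorm (c x 0).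
have b0 : 0 < b.
  by rewrite lt0r rnorm_ge0 andbT; apply: contra x0 => /eqP/rnorm0_eq0/eqP.
have /choice[ev evP] : forall ka : int * R, exists y : X,
    c y = (fun n => if n == ka.1 then ka.2%:C%C else 0) /\
    rnorm y <= `|ka.2| / b * rnorm x.
  move=> [k a] /=.
  have [||y cy yn] := @coord_dominated _ _ cX (`|a| / b) x (- k)
      (fun n => if n == k then a%:C%C else 0).
  - by rewrite divr_ge0// ltW.
  - move=> n; case: eqP => [->|_].
      by rewrite subrr rnorm_real -/b divfK// gt_eqF.
    by rewrite rnorm0 mulr_ge0 ?rnorm_ge0// divr_ge0// ltW.
  - by exists y.
exists (rnorm x / b), (fun k a => ev (k, a)); split.
- rewrite divr_gt0//; apply: lt_le_trans b0 _; exact: (coord_le cX).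
- by move=> k a n; have [-> _] := evP (k, a).
- move=> k a; have [_] := evP (k, a); move/le_trans; apply.
  by rewrite le_eqVlt; apply/orP; left; apply/eqP => /=; ring.
Qed.

Context (w : int -> R) (T : invertible_operator X).
Hypothesis w_gt0 : forall n, 0 < w n.
Hypothesis Tw : forall x n, c (T x) n = (w (n + 1))%:C%C * c x (n + 1).

Lemma coord_iter n x j :
  c (iter n T x) j = (wprod w (j + n%:Z) n)%:C%C * c x (j + n%:Z).
Proof.
elim: n j => [|n IH] j; first by rewrite wprod0 addr0 mul1r.
rewrite iterS Tw IH mulrA -rmorphM /=.
have -> : j + 1 + n%:Z = j + n.+1%:Z by rewrite -addrA -PoszD add1n.
congr (_%:C%C * _); rewrite wprodSr mulrC; congr (_ * w _).
by rewrite -addn1 PoszD addrA addrAC addrK.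
Qed.

Section UnitVectors.
Context (E : R) (ev : int -> R -> X).
Hypothesis E0 : 0 < E.
Hypothesis evE : forall k a n, c (ev k a) n = if n == k then a%:C%C else 0.
Hypothesis ev_le : forall k a, rnorm (ev k a) <= E * `|a|.

Lemma evD k a b : ev k (a + b) = ev k a + ev k b.
Proof.
apply: (coord_inj cX); apply/funext => n; rewrite (coordD cX) !evE.
by case: eqP => _; rewrite ?addr0// rmorphD.
Qed.

Lemma ev0 k : ev k 0 = 0.
Proof.
by apply: (coord_inj cX); apply/funext => n; rewrite coord0 evE; case: eqP.
Qed.

Lemma evB k a b : ev k (a - b) = ev k a - ev k b.
Proof. by apply/eqP; rewrite eq_sym subr_eq -evD subrK. Qed.

Lemma shift_ev k a : T (ev k a) = ev (k - 1) (w k * a).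
Proof.
apply: (coord_inj cX); apply/funext => n; rewrite Tw !evE (eq_sym n) subr_eq eq_sym.
by case: eqP => [->|_]; rewrite ?mulr0// rmorphM.
Qed.

Lemma weights_bounded : exists W : R, forall k, w k <= W.
Proof.
have [t t0 Tt] := bounded_operator_bound T; exists (t * E) => k.
have := coord_le cX (T (ev k 1)) (k - 1).
rewrite Tw subrK evE eqxx mulr1 rnorm_real gtr0_norm//.
move=> /le_trans; apply; apply: le_trans (Tt _) _; rewrite ler_wpM2l ?(ltW t0)//.
by have := ev_le k 1; rewrite normr1 mulr1.
Qed.

(** The amplitude at time i of an orbit started at M times the basis vector at
    position j and pushed by d along the basis direction at each step. *)
Fixpoint forced (d M : R) (j : int) (i : nat) : R :=
  if i is m.+1 then w (j - m%:Z) * forced d M j m + d else M.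

Lemma shift_forced d M j i :
  ev (j - i.+1%:Z) (forced d M j i.+1) =
  T (ev (j - i%:Z) (forced d M j i)) + ev (j - i.+1%:Z) d.
Proof.
by rewrite /= evD shift_ev -addrA -opprD -PoszD addn1.
Qed.

(** Reading the k-th coordinate at time j - k turns the vector equation into the
    scalar recursion; taking real parts and dividing by - d normalizes the
    forcing to 1. *)
Lemma bounded_forcing_of_solutions (e d : R) : 0 < e -> 0 < d ->
  (forall (j : int) (L : nat), exists y : nat -> X,
    (forall i, (i <= L)%N -> rnorm (y i) <= e) /\
    (forall i, (i < L)%N -> T (y i) = y i.+1 + ev (j - i.+1%:Z) d)) ->
  bounded_forcing w (e / d).
Proof.
move=> e0 d0 sol j L; have [y [ye yT]] := sol j L.
exists (fun i => - complex.Re (c (y i) (j - i%:Z)) / d); split.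
  move=> i iL; rewrite normrM normrN normfV (gtr0_norm d0).
  rewrite ler_pM2r ?invr_gt0//; apply: le_trans (ye i iL).
  exact: le_trans (ler_Re_rnorm _) (coord_le cX _ _).
move=> i iL; have := congr1 (fun x => complex.Re (c x (j - i.+1%:Z))) (yT i iL).
rewrite Tw (coordD cX) evE eqxx raddfD /= Re_realM.
have -> : j - i.+1%:Z + 1 = j - i%:Z by rewrite -addn1 PoszD opprD addrA subrK.
move=> h.
have -> : complex.Re (c (y i.+1) (j - i.+1%:Z)) =
    w (j - i%:Z) * complex.Re (c (y i) (j - i%:Z)) - d by rewrite h addrK.
by field; rewrite gt_eqF.
Qed.

(** The pseudotrajectory rests at 0 up to time 0 and is then forced along the
    diagonal; its difference from the shadowing orbit is the bounded solution. *)
Lemma shadowing_bounded_forcing : shadowing_property T ->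
  exists2 K : R, 0 < K & bounded_forcing w K.
Proof.
move=> /(_ 1 ltr01)[d d0 sh]; have dE : 0 < d / E by rewrite divr_gt0.
exists (1 / (d / E)); first by rewrite divr_gt0.
apply: bounded_forcing_of_solutions => // j L.
pose x (n : int) := if n is Posz m then ev (j - m%:Z) (forced (d / E) 0 j m) else 0.
have [n|y yx] := sh x.
  case: n => [n|[|n]].
  - rewrite -PoszD addn1 /x shift_forced opprD addrA subrr add0r rnormN.
    by apply: le_trans (ev_le _ _) _; rewrite gtr0_norm// mulrCA divff ?gt_eqF// mulr1.
  - by rewrite /x /= ev0 subr0 raddf0 rnorm0 ltW.
  - have -> : Negz n.+1 + 1 = Negz n by rewrite !NegzE -[n.+2]addn1 PoszD opprD addrNK.
    by rewrite /x raddf0 subr0 rnorm0 ltW.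
exists (fun i => iter i T y - x i); split=> [i _|i _]; first exact: ltW (yx i).
rewrite bounded_operatorB iterS -[T (x i)](addrK (ev (j - i.+1%:Z) (d / E))) -shift_forced.
by rewrite opprB addrA addrAC.
Qed.

(** The orbit x_i of T + a, of amplitude q_i, is started so large that its points
    on the segment are at mutual distance at least 2 rho.  Bumps of radius rho
    around them have disjoint supports, so their sum a has norm at most d, and it
    has Lipschitz constant at most L d / rho <= d.  Along x_i the conjugacy
    equation reads T (phi x_i) = phi x_(i+1) + a x_i. *)
Lemma stable_bounded_forcing : strongly_structurally_stable T ->
  exists2 K : R, 0 < K & bounded_forcing w K.
Proof.
move=> /(_ 1 ltr01)[d d0 stable]; have dE : 0 < d / E by rewrite divr_gt0.
exists (1 / (d / E)); first by rewrite divr_gt0.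
apply: bounded_forcing_of_solutions => // j L.
set s := d / E in dE *.
pose rho : R := L.+1%:R; have rho0 : 0 < rho by rewrite ltr0n.
(* q_i >= wprod w j i * M, so each term of the sum serves one i. *)
pose M := \sum_(i < L.+1) (2 * rho / wprod w j i).
pose q i := forced s M j i; pose x i := ev (j - i%:Z) (q i).
have q_ge i : (i <= L)%N -> 2 * rho <= q i.
  move=> iL; have Mq : wprod w j i * M <= q i.
    elim: i {iL} => [|i IH]; first by rewrite wprod0 mul1r.
    rewrite wprodSr mulrAC /q /=; apply: ler_wpDr; first exact: ltW.
    by rewrite mulrC ler_wpM2l// ltW.
  apply: le_trans Mq; have p0 : 0 < wprod w j i := wprod_gt0 w_gt0 j i.
  rewrite (mulrC (wprod w j i)) -ler_pdivrMr// /M (bigD1 (Ordinal (iL : (i < L.+1)%N)))//= lerDl.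
  apply: sumr_ge0 => k _; apply: divr_ge0; first by rewrite mulr_ge0// ltW.
  exact/ltW/wprod_gt0.
have x_far i m : (i <= L)%N -> i != m -> 2 * rho <= rnorm (x i - x m).
  move=> iL im; apply: le_trans (q_ge i iL) _.
  apply: le_trans (coord_le cX _ (j - i%:Z)); rewrite coordB !evE eqxx.
  rewrite (_ : (j - i%:Z == j - m%:Z) = false) ?subr0 ?rnorm_real ?ler_norm//.
  by rewrite (inj_eq (addrI j)) (inj_eq oppr_inj); apply/negbTE.
pose h i y := Num.max 0 (1 - rnorm (y - x i) / rho).
have h0 i y : 0 <= h i y by rewrite le_max lexx.
have h1 i y : h i y <= 1.
  by rewrite ge_max ler01 gerBl divr_ge0 ?rnorm_ge0// ltW.
have hpos i y : h i y != 0 -> rnorm (y - x i) < rho.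
  move=> hi; rewrite ltNge; apply: contra hi => rn.
  by rewrite /h max_l// subr_le0 ler_pdivlMr// mul1r.
have h_sep i m y : (i <= L)%N -> i != m -> h i y != 0 -> h m y = 0.
  move=> iL im hi; apply/eqP; apply: contraT => hm.
  have := x_far i m iL im; rewrite leNgt => /negP[].
  rewrite -(subrKA y); apply: le_lt_trans (ler_rnormD _ _) _.
  rewrite rnormB; have := hpos i y hi; have := hpos m y hm; lra.
have h_sum y : \sum_(i < L) h i y <= 1.
  have [/existsP[i hi]|/existsPn hz] := boolP [exists i : 'I_L, h i y != 0].
    rewrite (bigD1 i)//= big1 ?addr0// => m mi.
    by apply: (h_sep i) => //; [exact/ltnW/ltn_ord|rewrite eq_sym].
  by rewrite big1// => i _; apply/eqP; rewrite -[_ == _]negbK.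
have h_lip i y z : `|h i y - h i z| <= rnorm (y - z) / rho.
  have D y' z' : h i y' - h i z' <= rnorm (y' - z') / rho.
    rewrite lerBlDr ge_max addr_ge0 ?divr_ge0 ?rnorm_ge0 ?(ltW rho0)//=.
    rewrite [leRHS]addrC -lerBlDr.
    have hz : 1 - rnorm (z' - x i) / rho <= h i z' by rewrite le_max lexx orbT.
    apply: le_trans hz; rewrite -addrA -opprD lerD2l lerN2 -mulrDl.
    rewrite ler_wpM2r ?invr_ge0 ?(ltW rho0)//.
    by have := ler_rnormD (z' - y') (y' - x i); rewrite subrKA (rnormB z' y'); lra.
  by rewrite ler_norml D lerNl opprB rnormB D.
pose a y := \sum_(i < L) ev (j - i.+1%:Z) (s * h i y).
have s0 : 0 < s by [].
have Es : E * s = d by rewrite /s mulrCA divff ?mulr1// gt_eqF.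
have a_le y : rnorm (a y) <= d.
  apply: le_trans (ler_rnorm_sum _ _) _.
  apply: (@le_trans _ _ (\sum_(i < L) d * h i y)); last first.
    by rewrite -mulr_sumr ger_pMr.
  apply: ler_sum => i _; apply: le_trans (ev_le _ _) _.
  by rewrite (ger0_norm (mulr_ge0 (ltW s0) (h0 i y))) mulrA Es.
have a_lip y z : rnorm (a y - a z) <= d * rnorm (y - z).
  rewrite /a -sumrB; apply: le_trans (ler_rnorm_sum _ _) _.
  apply: (@le_trans _ _ (\sum_(i < L) d * (rnorm (y - z) / rho))).
    apply: ler_sum => i _; rewrite -evB -mulrBr; apply: le_trans (ev_le _ _) _.
    by rewrite normrM (gtr0_norm s0) (mulrA E) Es (ler_wpM2l (ltW d0)).
  rewrite sumr_const card_ord -mulr_natr -mulrA ler_wpM2l ?(ltW d0)//.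
  rewrite -mulrA ler_piMr ?rnorm_ge0// mulrC ler_pdivrMr// mul1r.
  by rewrite /rho ler_nat.
have a_lipC : (d%:C%C).-lipschitz a.
  by move=> [y z] _ /=; rewrite !rnormE -rmorphM lecR.
have [|||phi [phi1 _ phiT]] := stable a.
- by exists d.
- by apply: ge_ereal_sup => _ [y _ <-]; rewrite lee_fin.
- by apply: ereal_inf_lbound; exists d => //; split => //; exact: ltW.
have ax i : (i < L)%N -> a (x i) = ev (j - i.+1%:Z) s.
  move=> iL; rewrite /a (bigD1 (Ordinal iL))//= big1 ?addr0 => [|m mi].
    by rewrite /h subrr rnorm0 mul0r subr0 max_r// mulr1.
  have hi : h i (x i) != 0.
    by rewrite /h subrr rnorm0 mul0r subr0 max_r// oner_eq0.
  rewrite (h_sep i m (x i) (ltnW iL) _ hi) ?mulr0 ?ev0//.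
  by apply: contra mi => /eqP im; apply/eqP/val_inj; rewrite /= im.
exists (fun i => phi (x i)); split=> i iL.
  by rewrite -lee_fin (le_trans _ phi1)//; apply: ereal_sup_ubound; exists (x i).
have xS : x i.+1 = T (x i) + a (x i) by rewrite ax// /x /q shift_forced.
have := congr1 (fun f => f (x i)) phiT; rewrite /= bounded_operatorD -xS {1}xS -ax// -addrA.
by move=> /addrI ->; rewrite addrC.
Qed.

End UnitVectors.

(** [P] keeps the positions outside [D], those from which the weights contract
    downwards. *)
Lemma coordinate_splitting (D : set int) (C r : R) : 0 <= C -> 0 <= r < 1 ->
  (forall k n, ~ D k -> wprod w k n <= C * r ^+ n) ->
  (forall k n, D k -> 1 <= C * r ^+ n * wprod w (k + n%:Z) n) ->
  exists P, splitting T P C r.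
Proof.
move=> C0 r01 wC wD; have /andP[r0 r1] := r01.
have /choice[P PE] : forall x : X, exists y : X,
    c y = fun n => if `[< D n >] then 0 else c x n.
  move=> x; have [|y cy _] := @coord_dominated _ _ cX 1 x 0
    (fun n => if `[< D n >] then 0 else c x n) ler01; last by exists y.
  move=> n; rewrite mul1r addr0; case: ifP => _ //.
  by rewrite rnorm0 rnorm_ge0.
have Cr n : 0 <= C * r ^+ n by rewrite mulr_ge0 ?exprn_ge0.
exists P; split=> //.
- move=> x y; apply: (coord_inj cX); apply/funext => n.
  by rewrite coordB !PE; case: ifP => _; rewrite ?subrr// coordB.
- move=> n x; apply: (coord_norm_dominated (k := n%:Z)) => // j.
  rewrite coord_iter rnormM rnorm_real (gtr0_norm (wprod_gt0 w_gt0 _ _)) PE.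
  case: asboolP => [_|/wC wDj]; first by rewrite rnorm0 mulr0 mulr_ge0 ?rnorm_ge0.
  by rewrite ler_wpM2r ?rnorm_ge0.
- move=> n x; set y := iter n _ _.
  have yx : iter n T y = x - P x.
    rewrite /y; elim: n {y} (x - P x) => [//|n IH] y.
    by rewrite iterSr iterS iop_invK IH.
  apply: (coord_norm_dominated (k := - n%:Z)) => // j.
  have := coord_iter n y (j - n%:Z); rewrite yx subrK coordB PE.
  case: asboolP => [/wD wDj|_] E.
    rewrite -[c x _]subr0 E rnormM rnorm_real (gtr0_norm (wprod_gt0 w_gt0 _ _)) mulrA.
    apply: ler_peMl; first exact: rnorm_ge0.
    by have := wDj n; rewrite subrK.
  move/esym/eqP: E; rewrite subrr mulf_eq0 => /orP[|/eqP->].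
    by move=> /eqP/complexI/eqP; rewrite gt_eqF// wprod_gt0.
  by rewrite rnorm0 mulr_ge0 ?rnorm_ge0.
Qed.

Theorem shift_stable_iff_shadowing :
  strongly_structurally_stable T <-> shadowing_property T.
Proof.
have [E [ev [E0 evE ev_le]]] := unit_vectors.
have [W wW] := weights_bounded evE ev_le.
have key : (exists2 K : R, 0 < K & bounded_forcing w K) ->
    exists P C r, splitting T P C r.
  move=> [K K0 wK]; have [D [C [r [C0 r01 wC wD]]]] := wprod_dichotomy w_gt0 K0 wW wK.
  by have [P TP] := coordinate_splitting C0 r01 wC wD; exists P, C, r.
split=> [stable|shadowing].
- have [P [C [r TP]]] := key (stable_bounded_forcing E0 evE ev_le stable).
  exact: splitting_shadowing TP.
- have [P [C [r TP]]] := key (shadowing_bounded_forcing E0 evE ev_le shadowing).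
  exact: stable_of_splitting TP.
Qed.

End SequenceSpaces.

(** * The spaces ell_p and c_0 *)

Lemma ellp_sequence_space (R : realType) (p : R) (p1 : 1 <= p) :
  sequence_space (fun x : ellp p1 => ellp_seq x).
Proof.
have p0 : 0 < p := lt_le_trans ltr01 p1.
split=> //.
- by move=> x y xy; exact: val_inj.
- by move=> x n; exact: ellp_coord n (valP x).
- move=> M x k y M0 yx.
  have [yp yM] : y \in ellp_pred p1 /\ ellp_norm p y <= M * ellp_norm p x.
    apply/ellp_normP; first by rewrite mulr_ge0// ellp_norm_ge0.
    move=> s us; rewrite powRM ?ellp_norm_ge0//.
    apply: (@le_trans _ _ (\sum_(i <- s) M `^ p * rnorm (x (i + k)) `^ p)).
      apply: ler_sum => i _; rewrite -powRM ?rnorm_ge0//.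
      by apply: ge0_ler_powR; rewrite ?nnegrE ?rnorm_ge0 ?(ltW p0)// mulr_ge0 ?rnorm_ge0.
    rewrite -mulr_sumr ler_wpM2l ?powR_ge0//.
    rewrite -(big_map (fun i => i + k) predT (fun i => rnorm (x i) `^ p)).
    by apply: (ellp_sum_le (valP x)); rewrite map_inj_uniq//; exact: addIr.
  by exists (Ellp yp).
- have ep : (fun n : int => (n == 0)%:R : R[i]) \in ellp_pred p1.
    have [] // := (ellp_normP p1 (fun n : int => (n == 0)%:R : R[i]) ler01).2.
    move=> s us; rewrite powR1.
    apply: (@le_trans _ _ (\sum_(i <- s) (i == 0)%:R)).
      apply: ler_sum => i _; case: eqP => _; last by rewrite rnorm0 powR0// gt_eqF.
      by rewrite (rnorm_real 1) normr1 powR1.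
    rewrite -natr_sum lern1; have -> : (\sum_(i <- s) (i == 0%R) = count_mem 0%R s)%N.
      by rewrite -sum1_count [RHS]big_mkcond; apply: eq_bigr => i _ /=; case: (i == 0%R).
    by rewrite count_uniq_mem// leq_b1.
  by exists (Ellp ep); rewrite /= oner_eq0.
Qed.

Lemma c0_sequence_space (R : realType) :
  sequence_space (fun x : c0 R => c0_seq x).
Proof.
split=> //.
- by move=> x y xy; exact: val_inj.
- by move=> x n; exact: c0_coord n (valP x).
- move=> M x k y M0 yx.
  have y0 : y \in c0_pred.
    apply/asboolP => e e0; have /asboolP x0 := valP x.
    have M1 : 0 < M + 1 by rewrite ltr_wpDl.
    have [N xN] := x0 _ (divr_gt0 e0 M1).
    exists (N + `|k|)%N => n nN; apply: le_lt_trans (yx n) _.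
    have nk : (N <= `|(n + k)%R|)%N by lia.
    have := xN _ nk; rewrite ltr_pdivlMr// mulrC; apply: le_lt_trans.
    by rewrite ler_wpM2r ?rnorm_ge0// lerDl.
  exists (C0 y0) => //; apply/c0_normP => // n; apply: le_trans (yx n) _.
  by rewrite ler_wpM2l//; exact: c0_coord _ (valP x).
- have e0 : (fun n : int => (n == 0)%:R : R[i]) \in c0_pred.
    apply/asboolP => e e0; exists 1%N => n n1.
    have /negbTE -> : n != 0 by rewrite -absz_eq0 -lt0n.
    by rewrite rnorm0.
  by exists (C0 e0); rewrite /= oner_eq0.
Qed.

Theorem corollary1p2 (R : realType) (w : int -> R)
    (w_gt0 : forall n : int, 0 < w n) :
  (forall (p : R) (p1 : 1 <= p) (T : invertible_operator (ellp p1)),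
     (forall x : ellp p1, T x = weighted_shift w x :> (int -> complex R)) ->
     strongly_structurally_stable T <-> shadowing_property T)
  /\
  (forall T : invertible_operator (c0 R),
     (forall x : c0 R, T x = weighted_shift w x :> (int -> complex R)) ->
     strongly_structurally_stable T <-> shadowing_property T).
Proof.
split=> [p p1|] T Tw.
- apply: (shift_stable_iff_shadowing (ellp_sequence_space p1) w_gt0) => x n.
  by rewrite Tw.
- apply: (shift_stable_iff_shadowing (c0_sequence_space R) w_gt0) => x n.
  by rewrite Tw.
Qed.
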